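(* Let $n,m\in\mathbb N$ with $m\ge n$, let $\Omega\subset\mathbb R^n$ be open, let $A$ be a Young function satisfying (C1), (C2), (C3), and let $B$ be the associated function. Let $u\in V^{1,A}(\Omega,\mathbb R^m)$. Then $$\mathscr H^n_\infty(u(E))\le 2\kappa^{n+1}\|\nabla u\|^n_{L^A(\Omega)}\,\Phi_B\big(\mathscr L^n(E)\,n^{n/2}/\kappa\big)$$ for every set $E\subset\Omega$, where $\mathscr L^n$ is the outer Lebesgue measure and $\Phi_B(0)=0$, $\Phi_B(r)=r\,\big(B^{-1}(1/r)\big)^n$ for $r>0$.
   Context: $\mathscr H^n_\infty$ denotes the $n$-dimensional Hausdorff content in $\mathbb R^m$: $\mathscr H^n_\infty(F)=\inf\{\sum_i d(F_i)^n: F\subset\bigcup_iF_i\}$, $d$ = diameter. A Young function is a non-trivial convex $A\colon[0,\infty)\to[0,\infty]$ with $A(0)=0$; $\widetilde A(t)=\sup_{\tau\ge0}(\tau t-A(\tau))$. $\|f\|_{L^A(\Omega)}=\inf\{\lambda>0:\int_\Omega A(|f|/\lambda)dx\le1\}$. $V^{1,A}(\Omega,\mathbb R^m)=\{u\in L^1_{\rm loc}(\Omega,\mathbb R^m)$ weakly differentiable, $|\nabla u|\in L^A(\Omega)\}$. Conditions: (C1) if $n=1$, $\lim_{t\to\infty}t/A(t)=0$; if $n\ge2$, $\int^\infty (t/A(t))^{1/(n-1)}dt<\infty$. (C2) $0<A(t)<\infty$ for $t>0$. (C3) if $n=1$, $\lim_{t\to0^+}t/A(t)=\infty$; if $n\ge2$,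 $\int_0(t/A(t))^{1/(n-1)}dt=\infty$. The continuous representative of $u$ is used. $B=A$ if $n=1$; for $n\ge2$, $B$ is the Young conjugate of $t\mapsto t^{n'}\int_t^\infty\widetilde A(s)s^{-1-n'}ds$, $n'=n/(n-1)$. $\kappa=\kappa(n,m)$ is a constant such that for every $u\in V^{1,A}(\Omega,\mathbb R^m)$, every open cube $Q\subset\Omega$ and every $\lambda>0$ making the integral finite, $\frac{d(Q)^n}{\kappa}B\big(\frac{d(u(Q))}{\kappa\lambda d(Q)}\big)\le\int_QA(|\nabla u|/\lambda)dx$. *)

(* Defs.v *)
From mathcomp Require Import all_boot all_order all_algebra.
From mathcomp Require Import all_classical all_reals all_analysis.
Set Implicit Arguments. Unset Strict Implicit. Unset Printing Implicit Defensive.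
Import Order.TTheory GRing.Theory Num.Theory.
Import numFieldNormedType.Exports.
Local Open Scope classical_set_scope.
Local Open Scope ring_scope.

(* Points of R^k are k-tuples of reals; k.-tuple R carries the product
   (= Borel) sigma-algebra of mathcomp-analysis.  All metric notions below
   are Euclidean. *)

Definition edist {R : realType} {k : nat} (x y : k.-tuple R) : R :=
  Num.sqrt (\sum_(i < k) (tnth x i - tnth y i) ^+ 2).

Definition eopen {R : realType} {k : nat} (O : set (k.-tuple R)) : Prop :=
  forall x, O x -> exists r : R, 0 < r /\ forall y, edist x y < r -> O y.

Definition ecompact {R : realType} {k : nat} (K : set (k.-tuple R)) : Prop :=
  forall (I : Type) (U : I -> set (k.-tuple R)), (forall i, eopen (U i)) ->
    K `<=` \bigcup_i U i ->
    exists (N : nat) (f : 'I_N -> I), K `<=` \bigcup_k U (f k).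

Definition econt_on {R : realType} {n m : nat} (O : set (n.-tuple R))
  (f : n.-tuple R -> m.-tuple R) : Prop :=
  forall x, O x -> forall e : R, 0 < e -> exists d : R, 0 < d /\
    forall y, O y -> edist x y < d -> edist (f x) (f y) < e.

Definition rcont_on {R : realType} {n : nat} (O : set (n.-tuple R))
  (f : n.-tuple R -> R) : Prop :=
  forall x, O x -> forall e : R, 0 < e -> exists d : R, 0 < d /\
    forall y, O y -> edist x y < d -> `|f x - f y| < e.

(** Euclidean diameter, d(empty) = 0 *)
Definition ediam {R : realType} {k : nat} (F : set (k.-tuple R)) : \bar R :=
  ereal_sup ([set 0%E] `|`
             [set z | exists x y, F x /\ F y /\ z = (edist x y)%:E]).

Definition hcontent {R : realType} {m : nat} (n : nat) (F : set (m.-tuple R))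
  : \bar R :=
  ereal_inf [set s | exists G : (set (m.-tuple R))^nat,
    F `<=` \bigcup_j G j /\ s = (\sum_(j <oo) (ediam (G j)) ^+ n)%E].

(** closed boxes; a measure on the Borel sets of R^n is the Lebesgue measure
    iff it gives every closed box its volume (uniqueness of Lebesgue measure) *)
Definition closed_box {R : realType} {n : nat} (a b : n.-tuple R)
  : set (n.-tuple R) :=
  [set x | forall i, tnth a i <= tnth x i <= tnth b i].

Definition is_lebesgue_measure {R : realType} {n : nat}
  (mu : {measure set (n.-tuple R) -> \bar R}) : Prop :=
  forall a b : n.-tuple R, (forall i, tnth a i <= tnth b i) ->
    mu (closed_box a b) = (\prod_(i < n) (tnth b i - tnth a i))%:E.

Definition outer_leb {R : realType} {n : nat}
  (mu : {measure set (n.-tuple R) -> \bar R}) (E : set (n.-tuple R)) : \bar R :=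
  ereal_inf [set mu F | F in [set F | measurable F /\ E `<=` F]].

Definition Lloc {R : realType} {n : nat}
  (mu : {measure set (n.-tuple R) -> \bar R}) (O : set (n.-tuple R))
  (f : n.-tuple R -> R) : Prop :=
  measurable_fun O f /\
  forall K, ecompact K -> K `<=` O -> (\int[mu]_(x in K) (`|f x|)%:E < +oo)%E.

Definition shift {R : realType} {n : nat} (x : n.-tuple R) (j : 'I_n) (t : R)
  : n.-tuple R := [tuple tnth x i + (if i == j then t else 0) | i < n].

Definition pderiv {R : realType} {n : nat} (j : 'I_n) (phi : n.-tuple R -> R)
  : n.-tuple R -> R := fun x => derive1 (fun t => phi (shift x j t)) 0.

Fixpoint Ck {R : realType} {n : nat} (k : nat) (phi : n.-tuple R -> R) : Prop :=
  rcont_on setT phi /\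
  match k with
  | 0 => True
  | k'.+1 => forall j : 'I_n,
      (forall x, derivable (fun t => phi (shift x j t)) 0 1) /\ Ck k' (pderiv j phi)
  end.

Definition test_fun {R : realType} {n : nat} (O : set (n.-tuple R))
  (phi : n.-tuple R -> R) : Prop :=
  (forall k, Ck k phi) /\
  exists K, ecompact K /\ K `<=` O /\ forall x, ~ K x -> phi x = 0.

Definition weak_grad {R : realType} {n m : nat}
  (mu : {measure set (n.-tuple R) -> \bar R}) (O : set (n.-tuple R))
  (u : n.-tuple R -> m.-tuple R) (g : 'I_m -> 'I_n -> n.-tuple R -> R) : Prop :=
  (forall i, Lloc mu O (fun x => tnth (u x) i)) /\
  (forall i j, Lloc mu O (g i j)) /\
  forall phi, test_fun O phi -> forall i j,
    (\int[mu]_(x in O) (tnth (u x) i * pderiv j phi x)%:E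
     = - \int[mu]_(x in O) (g i j x * phi x)%:E)%E.

Definition gradnorm {R : realType} {n m : nat}
  (g : 'I_m -> 'I_n -> n.-tuple R -> R) (x : n.-tuple R) : R :=
  Num.sqrt (\sum_(i < m) \sum_(j < n) g i j x ^+ 2).

Definition orlicz_norm {R : realType} {n : nat}
  (mu : {measure set (n.-tuple R) -> \bar R}) (A : R -> R)
  (O : set (n.-tuple R)) (f : n.-tuple R -> R) : \bar R :=
  ereal_inf [set l%:E | l in [set l : R | 0 < l /\
    (\int[mu]_(x in O) (A (`|f x| / l))%:E <= 1)%E]].

Definition inV1A {R : realType} {n m : nat}
  (mu : {measure set (n.-tuple R) -> \bar R}) (A : R -> R)
  (O : set (n.-tuple R)) (u : n.-tuple R -> m.-tuple R)
  (g : 'I_m -> 'I_n -> n.-tuple R -> R) : Prop :=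
  weak_grad mu O u g /\ (orlicz_norm mu A O (gradnorm g) < +oo)%E.

(** Young function (real valued: with (C2) A is finite) *)
Definition young_fun {R : realType} (A : R -> R) : Prop :=
  A 0 = 0 /\ (forall t, 0 <= t -> 0 <= A t) /\
  (forall x y t, 0 <= x -> 0 <= y -> 0 <= t <= 1 ->
     A (t * x + (1 - t) * y) <= t * A x + (1 - t) * A y).

Definition cond_C1 {R : realType} (n : nat) (A : R -> R) : Prop :=
  if n == 1%N then (fun t => t / A t) x @[x --> +oo] --> 0
  else (\int[lebesgue_measure]_(t in `[1%R, +oo[)
          ((t / A t) `^ (1 / (n%:R - 1)))%:E < +oo)%E.

Definition cond_C2 {R : realType} (A : R -> R) : Prop :=
  forall t : R, 0 < t -> 0 < A t.

Definition cond_C3 {R : realType} (n : nat) (A : R -> R) : Prop :=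
  if n == 1%N then (fun t => t / A t) x @[x --> 0^'+] --> +oo
  else (\int[lebesgue_measure]_(t in `]0%R, 1%R])
          ((t / A t) `^ (1 / (n%:R - 1)))%:E = +oo)%E.

Definition yconj {R : realType} (F : R -> \bar R) (t : R) : \bar R :=
  ereal_sup [set ((tau * t)%:E - F tau)%E | tau in [set tau : R | 0 <= tau]].

Definition assocB {R : realType} (n : nat) (A : R -> R) : R -> \bar R :=
  if n == 1%N then fun t => (A t)%:E
  else
    let n' : R := n%:R / (n%:R - 1) in
    let At := yconj (fun t => (A t)%:E) in
    yconj (fun t => ((t `^ n')%:E *
       \int[lebesgue_measure]_(s in `[t, +oo[) (At s * (s `^ (- 1 - n'))%:E))%E).

Definition Bbar {R : realType} (n : nat) (A : R -> R) (x : \bar R) : \bar R :=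
  match x with
  | r%:E => assocB n A r
  | +oo%E => +oo%E
  | -oo%E => 0%E
  end.

Definition Binv {R : realType} (n : nat) (A : R -> R) (s : R) : \bar R :=
  ereal_sup [set t%:E | t in [set t : R | 0 <= t /\ (assocB n A t <= s%:E)%E]].

Definition PhiB {R : realType} (n : nat) (A : R -> R) (r : \bar R) : \bar R :=
  match r with
  | r%:E => if r == 0 then 0%E else (r%:E * (Binv n A r^-1) ^+ n)%E
  | +oo%E => +oo%E
  | -oo%E => 0%E
  end.

Definition open_cube {R : realType} {n : nat} (a : n.-tuple R) (l : R)
  : set (n.-tuple R) :=
  [set x | forall i, tnth a i < tnth x i < tnth a i + l].

Definition kappa_prop {R : realType} (n m : nat)
  (mu : {measure set (n.-tuple R) -> \bar R}) (kappa : R) : Prop :=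
  forall (O : set (n.-tuple R)) (A : R -> R) (u : n.-tuple R -> m.-tuple R)
         (g : 'I_m -> 'I_n -> n.-tuple R -> R),
    eopen O -> young_fun A -> cond_C1 n A -> cond_C2 A -> cond_C3 n A ->
    inV1A mu A O u g -> econt_on O u ->
    forall (a : n.-tuple R) (l : R), 0 < l -> open_cube a l `<=` O ->
    forall lam : R, 0 < lam ->
      (\int[mu]_(x in open_cube a l) (A (gradnorm g x / lam))%:E < +oo)%E ->
      let dQ := l * Num.sqrt n%:R in
      (((dQ ^+ n) / kappa)%:E *
         Bbar n A (ediam (u @` open_cube a l) * ((kappa * lam * dQ)^-1)%:E)
       <= \int[mu]_(x in open_cube a l) (A (gradnorm g x / lam))%:E)%E.

(* Main.v *)
(** Cover E by an open set G of almost the same measure and split G into disjoint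
    dyadic cubes Q_j.  If t_j = d(u(Q_j)) / (kappa lam d(Q_j)), the hypothesis on
    kappa gives d(Q_j)^n B(t_j) <= kappa a_j, where a_j is the integral of
    A(|grad u| / lam) over Q_j and the a_j sum to at most 1 when lam is at least
    the norm.  The function t |-> t^n is dominated by B in the sense that
    B(ct) >= c^n B(t) for c >= 1, so B(s) >= 1/W implies
    t^n <= s^n + W B(t) s^n for all t.  Summing over j bounds the content of u(E)
    by kappa^n lam^n s^n (n^(n/2) |G| + kappa W), which is at most
    2 kappa^(n+1) lam^n W s^n as soon as W >= n^(n/2) |G| / kappa; now let W, s and
    lam decrease to n^(n/2) |E| / kappa, B^{-1}(1/W) and the norm.
    If |E| = 0 or the norm vanishes, one needs moreover B(t) / t^n -> oo, which
    is what (C1) provides. *)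
Require Import Defs.
From mathcomp Require Import all_boot all_order all_algebra.
From mathcomp Require Import all_classical all_reals all_analysis.
From mathcomp Require Import measurable_realfun ring lra.
Import Order.TTheory GRing.Theory Num.Theory.
Import numFieldNormedType.Exports.
Local Open Scope classical_set_scope.
Local Open Scope ring_scope.
(* [edist] would otherwise denote the extended distance of the analysis library. *)
Local Notation edist := Defs.edist.

(** * Monotonicity of integrals of nonnegative functions *)

Section integral_facts.
Context d (T : measurableType d) (R : realType).
Variable mu : {measure set T -> \bar R}.
Local Open Scope ereal_scope.

(* No measurability is needed: the integral of a nonnegative function is the
   supremum of the integrals of the simple functions below it. *)
Lemma ge0_le_integral_nonmeasurable (D D' : set T) (f g : T -> \bar R) :
  D `<=` D' -> (forall x, D x -> 0 <= f x) -> (forall x, D' x -> 0 <= g x) ->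
  (forall x, D x -> f x <= g x) ->
  \int[mu]_(x in D) f x <= \int[mu]_(x in D') g x.
Proof.
move=> DD' f0 g0 fg; rewrite (ge0_integralE _ f0) (ge0_integralE _ g0).
apply: le_ereal_sup => _ [h hf <-]; exists h => // x.
apply: (le_trans (hf x)); rewrite !patchE.
case: ifPn => [/set_mem Dx|_]; first by rewrite (mem_set (DD' _ Dx)) fg.
by case: ifPn => // /set_mem/g0.
Qed.

End integral_facts.

(** * Tails of integrals on a half-line *)

Section tail.
Context {R : realType}.
Let mu := @lebesgue_measure R.

(** By monotone convergence the integrals over [1, i+1] increase to the full integral, which is
    finite; once they are within e of it, the remaining tail is at most e. *)
Lemma ge0_integral_tail_small (f : R -> \bar R) (e : R) :
  (0 < e)%R -> measurable_fun (`[1%R, +oo[ : set R) f ->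
  (forall x, (1 <= x)%R -> (0 <= f x)%E) ->
  (\int[mu]_(x in `[1%R, +oo[) f x < +oo)%E ->
  exists2 r, (1 <= r)%R & (\int[mu]_(x in `]r, +oo[) f x <= e%:E)%E.
Proof.
move=> e0 mf f0 foo.
have f0' x : x \in `[1%R, +oo[ -> (0 <= f x)%E by rewrite in_itv/= andbT => /f0.
pose F i := [set` `[1%R, i.+1%:R : R]].
have UF : \bigcup_i F i = [set` `[1%R, +oo[].
  apply/seteqP; split => x.
    by move=> [i _]; rewrite /F/= !in_itv/= => /andP[->].
  rewrite /= in_itv/= andbT => x1; exists (Num.truncn x) => //.
  by rewrite /F/= in_itv/= x1/= ltW// Num.Theory.truncnS_gt.
have mF i : measurable (F i) by exact: measurable_itv.
have nF : nondecreasing_seq F.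
  move=> i j ij; rewrite subsetEset => x; rewrite /F/= !in_itv/= => /andP[-> /=].
  by move=> /le_trans; apply; rewrite ler_nat.
have cvF : (\int[mu]_(x in F i) f x @[i --> \oo] --> \int[mu]_(x in `[1%R, +oo[) f x)%E.
  rewrite -UF; apply: ge0_nondecreasing_set_cvg_integral => //.
    move=> i; apply: measurable_funS mf => [|x].
      exact: measurable_itv.
    by rewrite -UF; exists i.
  by move=> i x; rewrite /F/= in_itv/= => /andP[/f0].
have I0 : (0 <= \int[mu]_(x in `[1%R, +oo[) f x)%E.
  by apply: integral_ge0 => x /f0'.
have Ifin : (\int[mu]_(x in `[1%R, +oo[) f x)%E \is a fin_num.
  by rewrite ge0_fin_numE.
have : (\forall i \near \oo, (\int[mu]_(x in `[1%R, +oo[) f x - e%:E <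
    \int[mu]_(x in F i) f x)%E).
  move: cvF; rewrite -(fineK Ifin) => /fine_cvgP[finF /cvgrPdist_lt /(_ _ e0) cF].
  near=> i.
  have fF : (\int[mu]_(x in F i) f x)%E \is a fin_num by near: i.
  rewrite -(fineK fF) -EFinB lte_fin ltrBlDr -ltrBlDl.
  apply: (le_lt_trans (ler_norm _)).
  by near: i.
move=> [N _ /(_ N (leqnn N)) HN].
exists N.+1%:R; first by rewrite ler1n.
have spl : [set` `[1%R, +oo[] = F N `|` [set` `]N.+1%:R : R, +oo[].
  rewrite /F; apply/seteqP; split => x/=; rewrite !in_itv/= !andbT.
    by move=> ->/=; case: (leP x N.+1%:R); [left|right].
  by case=> [/andP[]//|/ltW]; apply: le_trans; rewrite ler1n.
move: HN; rewrite spl (@ge0_integral_setU _ _ _ mu (F N) [set` `]N.+1%:R : R, +oo[]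
  (mF N) (measurable_itv _) f)//=; last 3 first.
- by have := mf; rewrite spl.
- move=> x; rewrite /F/= !in_itv/= andbT => -[/andP[/f0//]|xN].
  by apply: f0; rewrite (le_trans _ (ltW xN))// ler1n.
- apply/disj_setPRL => x/=; rewrite /F/= !in_itv/= andbT => xN.
  by move=> /andP[_]; rewrite leNgt xN.
have FN0 : (0 <= \int[mu]_(x in F N) f x)%E.
  by apply: integral_ge0 => x; rewrite /F/= in_itv/= => /andP[/f0].
have FNfin : (\int[mu]_(x in F N) f x)%E \is a fin_num.
  rewrite ge0_fin_numE// (le_lt_trans _ foo)//.
  by apply: ge0_le_integral_nonmeasurable => // x;
    rewrite /F/= ?in_itv/= ?andbT => /andP[]// /f0.
have J0 : (0 <= \int[mu]_(x in `]N.+1%:R : R, +oo[) f x)%E.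
  apply: integral_ge0 => x/=; rewrite in_itv/= andbT => xN; apply: f0.
  by rewrite (le_trans _ (ltW xN))// ler1n.
rewrite -(fineK FNfin) addeAC.
move: (\int[mu]_(x in `]N.+1%:R : R, +oo[) f x)%E J0 => [j|//|//] _.
- by rewrite -!EFinB -EFinD lte_fin lee_fin => ?; lra.
Unshelve. all: by end_near. Qed.

Lemma powRN_small (q e : R) : 0 < q -> 0 < e ->
  exists2 M, 0 < M & forall s, M <= s -> s `^ (- q) <= e.
Proof.
move=> q0 e0; exists (e `^ (- q^-1)); first exact: powR_gt0.
move=> s Ms; have M0 : 0 < e `^ (- q^-1) by exact: powR_gt0.
have s0 := lt_le_trans M0 Ms.
rewrite powRN -[leRHS]invrK lef_pV2 ?posrE ?powR_gt0 ?invr_gt0//.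
have -> : e^-1 = (e `^ (- q^-1)) `^ q.
  by rewrite -powRrM mulNr mulVf ?gt_eqF// powR_inv1// ltW.
by apply: ge0_ler_powR => //; rewrite ?nnegrE ltW.
Qed.

(** The primitive -s^(-q)/q vanishes at infinity, as [powRN_small] shows. *)
Lemma integral_powR_tail (q t : R) : 0 < q -> 0 < t ->
  (\int[mu]_(s in `[t, +oo[) (s `^ (- 1 - q))%:E = (t `^ (- q) / q)%:E)%E.
Proof.
move=> q0 t0.
pose F s : R := - (s `^ (- q)) / q.
have dF (x : R) : 0 < x -> is_derive x 1 F (x `^ (- 1 - q)).
  move=> x0; have := is_derive1_powR (- q) x0 => H.
  have -> : F = (- q^-1) \*: (fun s : R => s `^ (- q)).
    by apply/funext => s; rewrite /F/= /GRing.scale/= mulNr mulrC mulNr.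
  apply: is_derive_eq; rewrite /GRing.scale/= mulrA mulrNN mulVf ?gt_eqF// mul1r.
  by congr (_ `^ _); ring.
rewrite (@ge0_continuous_FTC2y _ (fun s => s `^ (- 1 - q)) F t 0)//.
- by rewrite add0e -EFinN /F mulNr opprK.
- by move=> x tx; rewrite powR_ge0.
- apply: continuous_in_subspaceT => x; rewrite inE/= in_itv/= andbT => tx.
  apply: differentiable_continuous; apply/derivable1_diffP.
  have := is_derive1_powR (- 1 - q) (lt_le_trans t0 tx) => H.
  exact: ex_derive.
- apply/cvgrPdist_le => /= e e0.
  have [M M0 HM] := powRN_small _ _ q0 (mulr_gt0 e0 q0).
  exists M; split; first exact: num_real.
  move=> x /ltW Mx; rewrite /F sub0r mulNr opprK ger0_norm.
    by rewrite ler_pdivrMr// HM.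
  by rewrite divr_ge0 ?powR_ge0// ltW.
- by move=> x tx; have := dF x (lt_trans t0 tx) => H; apply: ex_derive.
- have := dF t t0 => H.
  have : {for t, continuous F}.
    by apply: differentiable_continuous; apply/derivable1_diffP; apply: ex_derive.
  by move=> cF; apply: cvg_at_right_filter.
- move=> x; rewrite in_itv/= andbT => tx; have := dF x (lt_trans t0 tx) => H.
  by rewrite derive1E; apply: derive_val.
Qed.

End tail.

(** * Young functions and the tail of the conjugate *)

Section young.
Context {R : realType}.
Implicit Types A : R -> R.

(** Convexity between 0 and y, with A(0) = 0; in other words A(t)/t is nondecreasing. *)
Lemma young_fun_ratio A x y : young_fun A -> 0 <= x <= y -> 0 < y ->
  A x <= x / y * A y.
Proof.
move=> [A0 [_ Ac]] /andP[x0 xy] y0.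
have xy1 : 0 <= x / y <= 1.
  by rewrite divr_ge0 ?(ltW y0)//= ler_pdivrMr// mul1r.
have := Ac y 0 (x / y) (ltW y0) (lexx _) xy1.
by rewrite mulr0 addr0 A0 mulr0 addr0 divfK ?gt_eqF.
Qed.

Lemma young_fun_nd A x y : young_fun A -> 0 <= x <= y -> A x <= A y.
Proof.
move=> yA /andP[x0 xy]; have [A0 [Ap _]] := yA.
have [y0|y0] := ltP 0 y; last first.
  have -> : y = 0 by apply/eqP; rewrite eq_le y0 (le_trans x0 xy).
  have -> : x = 0 by apply/eqP; rewrite eq_le x0 (le_trans xy y0).
  by [].
apply: le_trans (young_fun_ratio _ _ _ yA _ y0) _; first by rewrite x0 xy.
by rewrite ler_piMl ?Ap ?(ltW y0)// ler_pdivrMr// mul1r.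
Qed.

(** [young_fun] constrains A on nonnegative reals only; composing with [Num.max 0] gives a function
    that is monotone on the whole line. *)
Lemma young_fun_measurable A : young_fun A ->
  measurable_fun [set: R] (fun x => A (Num.max 0 x)).
Proof.
move=> yA; apply: nondecreasing_measurable => // x y xy.
apply: young_fun_nd => //; rewrite le_max lexx/= ge_max !le_max lexx/=.
by rewrite xy orbT.
Qed.

Let mu := @lebesgue_measure R.

(* A(tau) / tau is nondecreasing, so {tau > 0 | A(tau) <= s tau} is an interval
   with left endpoint 0; its length, times s, dominates the conjugate at s. *)
Lemma yconj_le_integral A (s c : R) : young_fun A -> 0 < s -> 0 < c ->
  (yconj (fun t => (A t)%:E) s * c%:E <=
   \int[mu]_tau (if (0 < tau) && (A (Num.max 0 tau) <= s * tau)
                 then s * c else 0)%:E)%E.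
Proof.
move=> yA s0 c0; rewrite -lee_pdivlMr//; apply: ge_ereal_sup => _ [t t0 <-].
rewrite lee_pdivlMr// -EFinB -EFinM.
have I0 (D : set R) : (0 <= \int[mu]_(tau in D)
    (if (0 < tau) && (A (Num.max 0 tau) <= s * tau) then s * c else 0)%:E)%E.
  by apply: integral_ge0 => x _; case: ifP => _ //; rewrite lee_fin mulr_ge0 ?ltW.
have [tA|tA] := leP (A t) (s * t); last first.
  apply: le_trans (I0 _); rewrite lee_fin pmulr_lle0// subr_le0 mulrC ltW//.
have A0 : 0 <= A t by case: yA => _ [+ _]; exact.
have [->|tn0] := eqVneq t 0.
  have -> : A 0 = 0 by case: yA.
  by rewrite mul0r subr0 mul0r.
have tp : 0 < t by rewrite lt_neqAle eq_sym tn0.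
apply: (@le_trans _ _ (\int[mu]_(tau in `]0%R, t]) (cst (s * c)%:E) tau)%E).
  rewrite integral_cst//= lebesgue_measure_itv/= lte_fin tp -EFinB subr0 -EFinM lee_fin.
  rewrite (_ : s * c * t = t * s * c); last by ring.
  by rewrite ler_pM2r// gerBl.
apply: ge0_le_integral_nonmeasurable => //.
- by move=> x _; rewrite lee_fin mulr_ge0 ?ltW.
- by move=> x _; case: ifP => _ //; rewrite lee_fin mulr_ge0 ?ltW.
move=> x/=; rewrite in_itv/= => /andP[x0 xt]; rewrite x0 max_r ?(ltW x0)//=.
rewrite ifT//; apply: le_trans (young_fun_ratio _ _ _ yA _ tp) _.
  by rewrite xt ltW.
have := ler_wpM2l (divr_ge0 (ltW x0) (ltW tp)) tA.
by rewrite mulrCA divfK.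
Qed.

Section kernel.
Variables (A : R -> R) (q t : R).
Hypotheses (yA : young_fun A) (q0 : 0 < q) (t0 : 0 < t) (C2 : cond_C2 A).

(** The variables are z = (tau, s). The length bound for the conjugate contributes a factor s, which
    turns the weight s^(-1-(1+q)) into s^(-1-q). *)
Let K (z : R * R) : \bar R :=
  (if [&& 0 < z.1, A (Num.max 0 z.1) <= z.2 * z.1 & t <= z.2]
   then z.2 `^ (- 1 - q) else 0)%:E.

Let K_ge0 z : (0 <= K z)%E.
Proof. by rewrite /K; case: ifP => // _; rewrite lee_fin powR_ge0. Qed.

Let measurable_K : measurable_fun [set: R * R] K.
Proof.
apply/measurable_EFinP; apply: measurable_fun_ifT => //.
  apply: measurable_and; first exact: measurable_fun_ltr.
  apply: measurable_and; last exact: measurable_fun_ler.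
  apply: measurable_fun_ler; last exact: measurable_funM.
  exact: (measurableT_comp (young_fun_measurable _ yA)).
exact: (measurableT_comp (measurable_powR _)).
Qed.

(** For fixed tau the kernel lives on s >= max(t, A(tau)/tau), where the power integrates
    explicitly. *)
Let K_inner (tau : R) : 0 < tau ->
  (\int[mu]_s K (tau, s) <= (Num.max t (A tau / tau) `^ (- q) / q)%:E)%E.
Proof.
move=> tau0; rewrite -integral_powR_tail//; last by rewrite lt_max t0.
rewrite [leRHS]integral_mkcond.
apply: ge0_le_integral_nonmeasurable => //.
- move=> x _; rewrite patchE; case: ifP => // _.
  by rewrite lee_fin powR_ge0.
- move=> s _; rewrite patchE /K/= tau0 max_r ?(ltW tau0)//=.
  case: ifPn => [/andP[As ts]|_]; last by case: ifP => // _; rewrite lee_fin powR_ge0.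
  by rewrite mem_set//= in_itv/= andbT ge_max ts ler_pdivrMr.
Qed.

(* Tonelli: integrating s^(-1-q) over s >= max(t, A(tau)/tau) first turns the
   tail of the conjugate into an integral of (tau / A(tau))^q. *)
Lemma yconj_tail_le (r : R) : 0 <= r ->
  (\int[mu]_(s in `[t, +oo[)
     (yconj (fun t => (A t)%:E) s * (s `^ (- 1 - (1 + q)))%:E) <=
   (t `^ (- q) / q * r)%:E +
   (q^-1)%:E * \int[mu]_(tau in `]r, +oo[) ((tau / A tau) `^ q)%:E)%E.
Proof.
move=> r0.
apply: (@le_trans _ _ (\int[mu]_s \int[mu]_tau K (tau, s))%E).
  apply: ge0_le_integral_nonmeasurable => //.
  - move=> s/=; rewrite in_itv/= andbT => ts; apply: mule_ge0.
      apply: ereal_sup_ubound; exists 0 => //=; case: yA => -> _.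
      by rewrite mul0r sube0.
    by rewrite lee_fin powR_ge0.
  - by move=> s _; apply: integral_ge0.
  move=> s/=; rewrite in_itv/= andbT => ts; have s0 := lt_le_trans t0 ts.
  apply: le_trans (yconj_le_integral _ _ _ yA s0 (powR_gt0 _ s0)) _.
  apply: ge0_le_integral_nonmeasurable => //.
    by move=> x _; case: ifP => // _; rewrite lee_fin mulr_ge0 ?ltW// powR_gt0.
  move=> x _; rewrite /K/= ts andbT; case: ifP => // _.
  rewrite lee_fin -{1}(powRr1 (ltW s0)) -powRD; last first.
    by apply/implyP => _; rewrite gt_eqF.
  by rewrite le_eqVlt; apply/orP; left; apply/eqP; congr (_ `^ _); ring.
apply: (@le_trans _ _ (\int[mu]_tau \int[mu]_s K (tau, s))%E).
  rewrite le_eqVlt; apply/orP; left; apply/eqP.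
  exact/esym/(@fubini_tonelli _ _ _ _ R (@lebesgue_measure R)
    (@lebesgue_measure R) K measurable_K K_ge0).
have Ap x : 0 < x -> 0 < A x by apply: C2.
have mh : measurable_fun [set: R] (fun tau => (tau * (A (Num.max 0 tau)) `^ (-1)) `^ q).
  apply: (measurableT_comp (measurable_powR _)); apply: measurable_funM => //.
  exact: (measurableT_comp (measurable_powR _) (young_fun_measurable _ yA)).
(* In [K_inner] the maximum is bounded below by t when tau <= r and by A(tau)/tau when tau > r. The
   reciprocal of A is written as a power -1 so that measurability follows from that of powers. *)
pose g tau := (if tau <= r then t `^ (- q) / q else
   q^-1 * (tau * (A (Num.max 0 tau)) `^ (-1)) `^ q).
have mg : measurable_fun [set: R] g.
  apply: measurable_fun_ifT => //; first exact: measurable_fun_ler.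
  exact: measurable_funM.
have g0 x : (0 <= (g x)%:E)%E.
  rewrite lee_fin /g; case: ifP => _; first by rewrite divr_ge0 ?powR_ge0 ?ltW.
  by rewrite mulr_ge0 ?invr_ge0 ?powR_ge0 ?ltW.
apply: (@le_trans _ _ (\int[mu]_(tau in `]0%R, +oo[) (g tau)%:E)%E).
  rewrite [leRHS]integral_mkcond.
  apply: ge0_le_integral_nonmeasurable => //.
  - by move=> x _; apply: integral_ge0.
  - by move=> x _; rewrite patchE; case: ifP.
  move=> tau _; rewrite patchE; case: ifPn => [|].
    rewrite inE/= in_itv/= andbT => tau0.
    apply: (le_trans (K_inner _ tau0)); rewrite lee_fin /g.
    have m0 : 0 < Num.max t (A tau / tau) by rewrite lt_max t0.
    case: ifPn => _; last first.
      rewrite mulrC ler_pM2l ?invr_gt0// [Num.max 0 tau]max_r ?(ltW tau0)//.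
      rewrite powR_inv1 ?(ltW (Ap _ tau0))//.
      have a0 : 0 < A tau / tau by rewrite divr_gt0// Ap.
      have -> : tau / A tau = (A tau / tau) `^ (-1).
        by rewrite powR_inv1 ?invf_div// ltW.
      rewrite -powRrM mulN1r !powRN.
      rewrite lef_pV2 ?posrE ?powR_gt0//.
      apply: ge0_ler_powR; rewrite ?nnegrE ?(ltW q0) ?(ltW a0) ?(ltW m0)//.
      by rewrite le_max lexx orbT.
    rewrite ler_pM2r ?invr_gt0// !powRN lef_pV2 ?posrE ?powR_gt0//.
    by apply: ge0_ler_powR; rewrite ?nnegrE ?(ltW q0) ?(ltW t0) ?(ltW m0)// le_max lexx.
  rewrite notin_setE/= in_itv/= andbT => /negP tau0.
  rewrite (_ : (fun s => K (tau, s)) = cst 0%E) ?integral0//.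
  by apply/funext => s; rewrite /K/= (negbTE tau0).
have -> : [set` `]0%R : R, +oo[] = [set` `]0%R : R, r]] `|` [set` `]r, +oo[].
  apply/seteqP; split => x/=; rewrite !in_itv/= !andbT.
    by move=> ->/=; case: (leP x r); [left|right].
  by case=> [/andP[]//|]; apply: le_lt_trans.
rewrite ge0_integral_setU//=; last 2 first.
- by apply/measurable_EFinP; exact: measurable_funTS.
- apply/disj_setPRL => x/=; rewrite !in_itv/= andbT => xN.
  by move=> /andP[_]; rewrite leNgt xN.
apply: leeD.
  rewrite (eq_integral (cst (t `^ (- q) / q)%:E)); last first.
    by move=> x; rewrite inE/= in_itv/= /g => /andP[_ ->].
  rewrite integral_cst//= lebesgue_measure_itv/= lte_fin.
  case: ifPn => [_|_]; first by rewrite -EFinB subr0 -EFinM.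
  by rewrite mule0 lee_fin mulr_ge0// divr_ge0 ?powR_ge0 ?ltW.
apply: (@le_trans _ _ (\int[mu]_(tau in `]r, +oo[)
    ((q^-1)%:E * ((tau * (A (Num.max 0 tau)) `^ (-1)) `^ q)%:E))%E).
  apply: ge0_le_integral_nonmeasurable => //.
    by move=> x _; rewrite -EFinM lee_fin mulr_ge0 ?powR_ge0// invr_ge0 ltW.
  by move=> x/=; rewrite in_itv/= andbT /g => /lt_geF ->.
rewrite ge0_integralZl_EFin//; last 3 first.
- by move=> x _; rewrite lee_fin powR_ge0.
- by apply/measurable_EFinP; exact: measurable_funTS.
- by rewrite invr_ge0 ltW.
rewrite lee_pmul2l//; last by rewrite lte_fin invr_gt0.
apply: ge0_le_integral_nonmeasurable => //.
- by move=> x _; rewrite lee_fin powR_ge0.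
- by move=> x _; rewrite lee_fin powR_ge0.
move=> x/=; rewrite in_itv/= andbT => rx; have x0 := le_lt_trans r0 rx.
by rewrite max_r ?(ltW x0)// powR_inv1// ltW// Ap.
Qed.

End kernel.

Lemma yconj_tail_small A (q e : R) : young_fun A -> cond_C2 A -> 0 < q -> 0 < e ->
  (\int[mu]_(t in `[1%R, +oo[) ((t / A t) `^ q)%:E < +oo)%E ->
  exists2 t, 0 < t & (\int[mu]_(s in `[t, +oo[)
     (yconj (fun t => (A t)%:E) s * (s `^ (- 1 - (1 + q)))%:E) <= e%:E)%E.
Proof.
move=> yA C2 q0 e0 foo.
have Ap x : 0 < x -> 0 < A x by apply: C2.
have mh : measurable_fun [set: R] (fun tau => (tau * (A (Num.max 0 tau)) `^ (-1)) `^ q).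
  apply: (measurableT_comp (measurable_powR _)); apply: measurable_funM => //.
  exact: (measurableT_comp (measurable_powR _) (young_fun_measurable _ yA)).
(* The two terms of [yconj_tail_le] are each brought below e/2: the tail, which carries the factor
   1/q, by the choice of r; then, with r fixed, t^(-q) r / q by the choice of t. *)
have [|||r r1 Hr] := @ge0_integral_tail_small R
  (fun t => ((t / A t) `^ q)%:E) (q * (e / 2)) _ _ _ foo.
- by rewrite mulr_gt0// divr_gt0.
- apply/measurable_EFinP; apply: (eq_measurable_fun _ _ (measurable_funTS mh)) => x.
  rewrite inE/= in_itv/= andbT => x1; have x0 : 0 < x by rewrite (lt_le_trans _ x1).
  by rewrite max_r ?(ltW x0)// powR_inv1// ltW// Ap.
- by move=> x _; rewrite lee_fin powR_ge0.
have r0 : 0 < r by rewrite (lt_le_trans _ r1).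
have e2 : 0 < q * (e / 2) / r by rewrite divr_gt0// mulr_gt0// divr_gt0.
have [t t0 Ht] := powRN_small _ _ q0 e2.
exists t => //; apply: le_trans (yconj_tail_le _ _ _ yA q0 t0 C2 _ (ltW r0)) _.
rewrite (_ : e = e / 2 + e / 2); last by field.
rewrite EFinD; apply: leeD.
  have := Ht t (lexx _); rewrite ler_pdivlMr// lee_fin => H.
  by rewrite mulrAC ler_pdivrMr// (le_trans H)// mulrC.
apply: (@le_trans _ _ ((q^-1)%:E * (q * (e / 2))%:E)%E).
  by rewrite lee_pmul2l// lte_fin invr_gt0.
by rewrite -EFinM mulKf// gt_eqF.
Qed.

End young.

(** * Scaling and growth of the associated function B *)

Section assocB.
Context {R : realType}.
Variables (n : nat) (A : R -> R).
Hypotheses (n1 : (1 <= n)%N) (yA : young_fun A) (C1 : cond_C1 n A) (C2 : cond_C2 A).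

Let mu := @lebesgue_measure R.

(** The exponent of (C1) for n >= 2; then 1 + q = n/(n-1) = n'. *)
Let q : R := 1 / (n%:R - 1).

Let At : R -> \bar R := yconj (fun t => (A t)%:E).

Let I (t : R) : \bar R :=
  (\int[mu]_(s in `[t, +oo[) (At s * (s `^ (- 1 - (1 + q)))%:E))%E.

(** The function whose Young conjugate is B when n >= 2. *)
Let C (t : R) : \bar R := ((t `^ (1 + q))%:E * I t)%E.

Let At_ge0 s : (0 <= At s)%E.
Proof.
apply: ereal_sup_ubound; exists 0 => //=; case: yA => -> _.
by rewrite mul0r sube0.
Qed.

Let integrand_ge0 s : (0 <= At s * (s `^ (- 1 - (1 + q)))%:E)%E.
Proof. by rewrite mule_ge0// lee_fin powR_ge0. Qed.

Let I_ge0 t : (0 <= I t)%E.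
Proof. by apply: integral_ge0 => s _; exact: integrand_ge0. Qed.

Let I_ni s t : s <= t -> (I t <= I s)%E.
Proof.
move=> st; apply: ge0_le_integral_nonmeasurable => // x/=.
by rewrite !in_itv/= !andbT; exact: le_trans.
Qed.

Let C_ge0 t : (0 <= C t)%E.
Proof. by rewrite mule_ge0// lee_fin powR_ge0. Qed.

Let nB1 : (1 < n)%N -> (n.-1)%:R = n%:R - 1 :> R.
Proof. by move=> n2; rewrite -subn1 natrB// ltnW. Qed.

Let nB1_gt0 : (1 < n)%N -> 0 < n%:R - 1 :> R.
Proof. by move=> n2; rewrite -nB1// ltr0n -ltnS prednK// ltnW. Qed.

Let q_gt0 : (1 < n)%N -> 0 < q.
Proof. by move=> n2; rewrite divr_gt0// nB1_gt0. Qed.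

Let assocBE : (1 < n)%N -> assocB n A = yconj C.
Proof.
move=> n2; rewrite /assocB ifF; last by apply/negbTE; rewrite neq_ltn n2 orbT.
suff -> : n%:R / (n%:R - 1) = 1 + q by [].
by rewrite /q; field; rewrite gt_eqF// nB1_gt0.
Qed.

Let powR_predn (x : R) : (1 < n)%N -> 0 <= x -> (x ^+ n.-1) `^ q = x.
Proof.
move=> n2 x0; rewrite -powR_mulrn// -powRrM nB1// /q mulrA mulr1.
by rewrite divff ?powRr1// gt_eqF// nB1_gt0.
Qed.

Let powR_1q (x : R) : (1 < n)%N -> 0 <= x -> x `^ (1 + q) = x * x `^ q.
Proof.
move=> n2 x0; rewrite powRD ?powRr1//.
by apply/implyP; rewrite gt_eqF// ltr_wpDl// q_gt0.
Qed.

Lemma assocB_ge0 t : 0 <= t -> (0 <= assocB n A t)%E.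
Proof.
have [n2|] := ltnP 1 n; last first.
  case: n n1 => [//|[|//]] _ _ t0.
  by rewrite /assocB/= lee_fin; case: yA => _ [+ _]; exact.
move=> t0; rewrite assocBE//; apply: ereal_sup_ubound; exists 0 => //=.
rewrite /C powR0 ?mul0e ?mul0r ?sube0// gt_eqF//.
by rewrite ltr_wpDl// q_gt0.
Qed.

Lemma assocB_0 : assocB n A 0 = 0%E.
Proof.
apply/eqP; rewrite eq_le assocB_ge0// andbT.
have [n2|] := ltnP 1 n; last first.
  by case: n n1 => [//|[|//]] _ _; rewrite /assocB/= lee_fin; case: yA => ->.
rewrite assocBE//; apply: ge_ereal_sup => _ [t _ <-].
by rewrite mulr0 add0e oppe_le0.
Qed.

(** The factor c^(n-1) raised to the power 1 + q is c^n, and the tail [I] is nonincreasing. *)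
Let C_scale c s : (1 < n)%N -> 1 <= c -> 0 <= s ->
  (C (c ^+ n.-1 * s) <= (c ^+ n)%:E * C s)%E.
Proof.
move=> n2 c1 s0; have c0 : 0 <= c by rewrite (le_trans _ c1).
rewrite /C powRM ?exprn_ge0// powR_1q ?exprn_ge0//.
rewrite powR_predn// -exprSr prednK// EFinM -muleA.
apply: lee_wpmul2l; first by rewrite lee_fin exprn_ge0.
apply: lee_wpmul2l; first by rewrite lee_fin powR_ge0.
by apply: I_ni; rewrite ler_peMl// exprn_ege1.
Qed.

(** For n = 1 this is [young_fun_ratio]. For n >= 2, a competitor s in the supremum at t is replaced
    by c^(n-1) s in the supremum at c t: the product is multiplied by exactly c^n, the subtracted
    term by at most c^n. *)
Lemma assocB_scale c t : 1 <= c -> 0 <= t ->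
  ((c ^+ n)%:E * assocB n A t <= assocB n A (c * t))%E.
Proof.
move=> c1 t0; have c0 : 0 < c by rewrite (lt_le_trans _ c1).
have [n2|] := ltnP 1 n; last first.
  case: n n1 => [//|[|//]] _ _.
  rewrite /assocB/= expr1 lee_fin.
  have [->|tn0] := eqVneq t 0; first by rewrite mulr0; case: yA => ->; rewrite mulr0.
  have tp : 0 < t by rewrite lt_neqAle eq_sym tn0.
  have ct : 0 < c * t by rewrite mulr_gt0.
  have := young_fun_ratio _ t (c * t) yA; rewrite t0 ler_peMl// => /(_ isT ct).
  by rewrite invfM mulrCA divff// mulr1 mulrC ler_pdivlMr// mulrC.
rewrite assocBE// -lee_pdivlMl ?exprn_gt0//; apply: ge_ereal_sup => _ [s /= s0 <-].
rewrite lee_pdivlMl ?exprn_gt0//.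
apply: (@le_trans _ _ ((c ^+ n.-1 * s * (c * t))%:E - C (c ^+ n.-1 * s))%E); last first.
  apply: ereal_sup_ubound; exists (c ^+ n.-1 * s) => //=.
  by rewrite mulr_ge0// exprn_ge0// ltW.
have := C_scale _ _ n2 c1 s0; have := C_ge0 s.
case: (C s) => [r|_ _|//] /=.
- move=> _; rewrite -EFinM => H.
  rewrite -EFinB -EFinM.
  apply: (@le_trans _ _ ((c ^+ n.-1 * s * (c * t))%:E - (c ^+ n * r)%:E)%E); last first.
    by rewrite leeD2l// leeN2.
  rewrite -EFinB lee_fin le_eqVlt; apply/orP; left; apply/eqP.
  have -> : c ^+ n = c * c ^+ n.-1 by rewrite -exprS prednK.
  by ring.
- by rewrite addeNy gt0_muleNy ?leNye// lte_fin exprn_gt0.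
Qed.

(** For n = 1 this is (C1). For n >= 2 the competitor tau = 2 N t^(n-1) gives tau t = 2 N t^n, and
    C(tau) takes away at most half of it because (C1) makes the tail [I] small. *)
Lemma assocB_growth M : exists2 t0, 0 < t0 &
  forall t, t0 <= t -> ((M * t ^+ n)%:E <= assocB n A t)%E.
Proof.
(* A bound N >= 1 makes 1/N meaningful and gives tau >= t^(n-1) below. *)
pose N := Num.max M 1.
have N0 : 0 < N by rewrite lt_max ltr01 orbT.
have MN : M <= N by rewrite le_max lexx.
suff [t0 t0p H] : exists2 t0, 0 < t0 &
    forall t, t0 <= t -> ((N * t ^+ n)%:E <= assocB n A t)%E.
  exists t0 => // t tt; apply: le_trans (H t tt); rewrite lee_fin.
  by rewrite ler_wpM2r// exprn_ge0// (le_trans _ tt)// ltW.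
have [n2|] := ltnP 1 n; last first.
  move: C1; case: n n1 => [//|[|//]] _; rewrite /cond_C1/= => + _.
  have Ni : 0 < N^-1 by rewrite invr_gt0.
  move=> /cvgrPdist_le /(_ _ Ni)[t0 [_ H]]; exists (Num.max 1 (t0 + 1)) => [|t].
    by rewrite lt_max ltr01.
  rewrite ge_max => /andP[t1 tt].
  have tp : 0 < t by rewrite (lt_le_trans _ t1).
  have Ap : 0 < A t by apply: C2.
  have /H : t0 < t by rewrite (lt_le_trans _ tt)// ltrDl.
  rewrite sub0r normrN (ger0_norm (divr_ge0 (ltW tp) (ltW Ap))) ler_pdivrMr//.
  by rewrite ler_pdivlMl// expr1 lee_fin.
move: C1; rewrite /cond_C1 ifF => [foo|]; last by apply/negbTE; rewrite neq_ltn n2 orbT.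
(* Since tau^(1+q) = tau (2N)^q t, a tail of at most (2N)^(-q)/2 yields C(tau) <= tau t / 2. *)
have d0 : 0 < (2 * N) `^ (- q) / 2 by rewrite divr_gt0// powR_gt0// mulr_gt0.
have [s0 s0p Hs] := yconj_tail_small _ _ _ yA C2 (q_gt0 n2) d0 foo.
exists (Num.max 1 s0) => [|t]; first by rewrite lt_max ltr01.
rewrite ge_max => /andP[t1 st].
have tp : 0 < t by rewrite (lt_le_trans _ t1).
rewrite assocBE//.
pose tau := 2 * N * t ^+ n.-1.
have tau0 : 0 < tau by rewrite !mulr_gt0// exprn_gt0.
have s0tau : s0 <= tau.
  rewrite (le_trans st)// (@le_trans _ _ (t ^+ n.-1))//.
    by rewrite -[leLHS]expr1 ler_weXn2l// -ltnS prednK.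
  rewrite ler_peMl ?exprn_ge0 ?ltW// .
  have : 1 <= N by rewrite le_max lexx orbT.
  by move=> ?; lra.
apply: (@le_trans _ _ ((tau * t)%:E - C tau)%E); last first.
  by apply: ereal_sup_ubound; exists tau => //=; exact: ltW.
have : (C tau <= (tau * t / 2)%:E)%E.
  rewrite /C; apply: (@le_trans _ _ ((tau `^ (1 + q))%:E * ((2 * N) `^ (- q) / 2)%:E)%E).
    apply: lee_wpmul2l; first by rewrite lee_fin powR_ge0.
    exact: le_trans (I_ni _ _ s0tau) Hs.
  rewrite -EFinM lee_fin (powR_1q _ n2 (ltW tau0)).
  rewrite {2}/tau powRM ?exprn_ge0 ?mulr_ge0 ?(ltW N0) ?(ltW tp)//.
  rewrite (powR_predn _ n2 (ltW tp)) powRN.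
  have : (2 * N) `^ q != 0 by rewrite gt_eqF// powR_gt0// mulr_gt0.
  move: ((2 * N) `^ q) => z z0.
  by rewrite le_eqVlt; apply/orP; left; apply/eqP; field.
have := C_ge0 tau; case: (C tau) => [r|//|//] _.
rewrite -EFinB !lee_fin => H.
have -> : t ^+ n = t * t ^+ n.-1 by rewrite -exprS prednK.
rewrite /tau in H *.
move: H; move: (t ^+ n.-1) => z H; lra.
Qed.

End assocB.

(** * Euclidean distance and diameter *)

Section euclid.
Context {R : realType}.

(** The sum of the squares of Y a_i - P b_i equals Y (X Y - P^2); if Y = 0, all b_i vanish. *)
Lemma CauchySchwarz_sum k (a b : 'I_k -> R) :
  (\sum_i a i * b i) ^+ 2 <= (\sum_i a i ^+ 2) * (\sum_i b i ^+ 2).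
Proof.
set X := \sum_i a i ^+ 2; set Y := \sum_i b i ^+ 2; set P := \sum_i a i * b i.
have : 0 <= \sum_i (Y * a i - P * b i) ^+ 2.
  by apply: sumr_ge0 => i _; exact: sqr_ge0.
have -> : \sum_i (Y * a i - P * b i) ^+ 2 = Y * (X * Y - P ^+ 2).
  rewrite (eq_bigr (fun i => Y ^+ 2 * a i ^+ 2 + - (2 * Y * P) * (a i * b i) +
      P ^+ 2 * b i ^+ 2)); last by move=> i _; ring.
  by rewrite !big_split/= -!mulr_sumr -/X -/Y -/P; ring.
have Y0 : 0 <= Y by apply: sumr_ge0 => i _; exact: sqr_ge0.
have [Yp|] := ltP 0 Y; first by rewrite pmulr_rge0// subr_ge0.
move=> YN; have {YN Y0} Y0 : Y == 0 by rewrite eq_le YN Y0.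
move=> _; move: Y0; rewrite psumr_eq0 => [/allP b0|i _]; last exact: sqr_ge0.
have -> : P = 0.
  apply: big1 => i _; have := b0 i (mem_index_enum i).
  by rewrite /= sqrf_eq0 => /eqP ->; rewrite mulr0.
by rewrite expr0n mulr_ge0//; apply: sumr_ge0 => i _; exact: sqr_ge0.
Qed.

Lemma edist_ge0 k (x y : k.-tuple R) : 0 <= edist x y.
Proof. exact: sqrtr_ge0. Qed.

Lemma edistC k (x y : k.-tuple R) : edist x y = edist y x.
Proof.
rewrite /edist; congr Num.sqrt; apply: eq_bigr => i _.
by rewrite -sqrrN opprB.
Qed.

Lemma edist_triangle k (x y z : k.-tuple R) :
  edist x z <= edist x y + edist y z.
Proof.
rewrite -(@ler_pXn2r _ 2)// ?nnegrE ?addr_ge0 ?edist_ge0//.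
have s0 (v w : k.-tuple R) : 0 <= \sum_(i < k) (tnth v i - tnth w i) ^+ 2.
  by apply: sumr_ge0 => i _; exact: sqr_ge0.
rewrite sqrrD /edist !sqr_sqrtr// -sqrtrM//.
set a := fun i => tnth x i - tnth y i; set b := fun i => tnth y i - tnth z i.
have -> : \sum_(i < k) (tnth x i - tnth z i) ^+ 2 =
    \sum_i a i ^+ 2 + (\sum_i a i * b i) *+ 2 + \sum_i b i ^+ 2.
  by rewrite -sumrMnl -!big_split/=; apply: eq_bigr => i _; rewrite /a /b; ring.
rewrite lerD2r lerD2l lerMn2r/=.
have := CauchySchwarz_sum _ a b => H.
apply: (le_trans (ler_norm _)); rewrite -sqrtr_sqr.
by rewrite ler_wsqrtr.
Qed.

Lemma ler_tnth_edist k (x y : k.-tuple R) i : `|tnth x i - tnth y i| <= edist x y.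
Proof.
rewrite -sqrtr_sqr ler_wsqrtr// (bigD1 i)//= lerDl.
by apply: sumr_ge0 => j _; exact: sqr_ge0.
Qed.

Lemma edist_le k (x y : k.-tuple R) e : 0 <= e ->
  (forall i, `|tnth x i - tnth y i| <= e) -> edist x y <= Num.sqrt k%:R * e.
Proof.
move=> e0 H; rewrite -[e in leRHS]ger0_norm// -sqrtr_sqr -sqrtrM ?ler0n//.
apply: ler_wsqrtr; rewrite mulr_natl -[in leRHS](card_ord k) -sumr_const.
apply: ler_sum => i _; rewrite -real_normK ?num_real//.
by rewrite lerXn2r// nnegrE.
Qed.

Lemma ediam_ge0 k (S : set (k.-tuple R)) : (0 <= ediam S)%E.
Proof. by apply: ereal_sup_ubound; left. Qed.

End euclid.

(** * Half-open cubes: measurability, volume, oscillation *)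

Section half_open_cube.
Context {R : realType} {n : nat}.
Implicit Types a x : n.-tuple R.

(** Half-open, so that the dyadic cubes of one size tile the space without overlap. *)
Definition half_open_cube a (l : R) : set (n.-tuple R) :=
  [set x | forall i, tnth a i <= tnth x i < tnth a i + l].

Lemma sub_open_half_open_cube a l : open_cube a l `<=` half_open_cube a l.
Proof. by move=> x H i; have /andP[/ltW -> ->] := H i. Qed.

Lemma measurable_tuple_box (B : 'I_n -> set R) :
  (forall i, measurable (B i)) ->
  measurable [set x : n.-tuple R | forall i, B i (tnth x i)].
Proof.
move=> mB.
rewrite (_ : [set _ | _] = \bigcap_(i in [set: 'I_n]) ((@tnth n R)^~ i @^-1` B i)).
  apply: fin_bigcap_measurable => // i _.
  rewrite -[X in measurable X]setTI.
  have mt : measurable_fun [set: n.-tuple R] ((@tnth n R)^~ i) by exact: measurable_tnth.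
  exact: mt.
by apply/seteqP; split => x /= H i; [move=> _|]; exact: H.
Qed.

Lemma measurable_half_open_cube a l : measurable (half_open_cube a l).
Proof.
rewrite (_ : half_open_cube a l = [set x : n.-tuple R | forall i,
    [set` `[tnth a i, tnth a i + l[] (tnth x i)]).
  apply: (measurable_tuple_box (fun i => [set` `[tnth a i, tnth a i + l[])) => i.
  exact: measurable_itv.
by apply/seteqP; split => x /= H i; move: (H i); rewrite in_itv.
Qed.

Lemma measurable_closed_box a b : measurable (closed_box a b).
Proof.
rewrite (_ : closed_box a b = [set x : n.-tuple R | forall i,
    [set` `[tnth a i, tnth b i]] (tnth x i)]).
  apply: (measurable_tuple_box (fun i => [set` `[tnth a i, tnth b i]])) => i.
  exact: measurable_itv.
by apply/seteqP; split => x /= H i; move: (H i); rewrite in_itv.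
Qed.

Lemma Bernoulli_ineq (x : R) k : 0 <= x <= 1 -> 1 - k%:R * x <= (1 - x) ^+ k.
Proof.
move=> /andP[x0 x1]; elim: k => [|k IH]; first by rewrite mul0r subr0.
have x1' : 0 <= 1 - x by rewrite subr_ge0.
rewrite exprS; apply: le_trans (ler_wpM2l x1' IH).
have : 0 <= k%:R * x * x by rewrite !mulr_ge0.
by rewrite -natr1 => H; lra.
Qed.

(** The cube contains closed boxes of side l (1 - e), whose volume is at least l^n (1 - n e) by
    Bernoulli's inequality; then e tends to 0. *)
Lemma lebesgue_half_open_cube_ge (mu : {measure set (n.-tuple R) -> \bar R}) a l :
  is_lebesgue_measure mu -> 0 < l -> ((l ^+ n)%:E <= mu (half_open_cube a l))%E.
Proof.
move=> Lmu l0.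
have H e : 0 < e < 1 -> ((l ^+ n * (1 - n%:R * e))%:E <= mu (half_open_cube a l))%E.
  move=> /andP[e0 e1].
  pose b := [tuple tnth a i + l * (1 - e) | i < n].
  apply: (@le_trans _ _ (mu (closed_box a b))).
    rewrite Lmu; last first.
      by move=> i; rewrite tnth_mktuple lerDl mulr_ge0 ?subr_ge0 ?ltW.
    rewrite (eq_bigr (fun=> l * (1 - e))); last first.
      by move=> i _; rewrite tnth_mktuple addrAC subrr add0r.
    rewrite prodr_const card_ord exprMn lee_fin ler_pM2l ?exprn_gt0//.
    by apply: Bernoulli_ineq; rewrite !ltW.
  apply: le_measure; rewrite ?inE.
  - exact: measurable_closed_box.
  - exact: measurable_half_open_cube.
  move=> x H i; have := H i; rewrite tnth_mktuple => /andP[-> /=] /le_lt_trans; apply.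
  by rewrite ltrD2l gtr_pMr// gtrBl.
have m0 : (0 <= mu (half_open_cube a l))%E by exact: measure_ge0.
move: H m0; case: (mu _) => [v|_ _|_]; last 2 first.
- by rewrite leey.
- by rewrite leNgt ltNy0.
move=> H _; rewrite lee_fin; apply/ler_addgt0Pr => e e0.
have ln0 : 0 < l ^+ n by rewrite exprn_gt0.
have c0 : 0 < n%:R * l ^+ n + 1 by rewrite ltr_wpDl// mulr_ge0// ltW.
pose d := Num.min (1 / 2) (e / (n%:R * l ^+ n + 1)).
have d01 : 0 < d < 1.
  rewrite /d lt_min gt_min; apply/andP; split; last by apply/orP; left; lra.
  by rewrite divr_gt0//= divr_gt0.
have := H d d01; rewrite lee_fin => {}H.
have : d <= e / (n%:R * l ^+ n + 1) by rewrite ge_min lexx orbT.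
rewrite ler_pdivlMr// => H2.
have : n%:R * l ^+ n * d <= e.
  apply: le_trans H2; rewrite [leRHS]mulrC ler_wpM2r ?lerDl//.
  by case/andP: d01 => /ltW.
by move=> H3; lra.
Qed.

(** The hypothesis on kappa concerns open cubes, the tiling half-open ones. A point moved slightly
    towards the centre enters the open cube, and by continuity its image moves little. *)
Lemma le_ediam_half_open_cube m (O : set (n.-tuple R))
    (u : n.-tuple R -> m.-tuple R) a l :
  0 < l -> half_open_cube a l `<=` O -> econt_on O u ->
  (ediam (u @` half_open_cube a l) <= ediam (u @` open_cube a l))%E.
Proof.
move=> l0 HO uc.
have near x e : half_open_cube a l x -> 0 < e ->
    exists2 x', open_cube a l x' & edist (u x) (u x') < e.
  move=> Hx e0; have [d [d0 Hd]] := uc x (HO _ Hx) e e0.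
  pose s := Num.sqrt n%:R * l + 1.
  have s0 : 0 < s by rewrite ltr_wpDl// mulr_ge0 ?sqrtr_ge0// ltW.
  (* The fraction of the way to the centre: the displacement is at most th times sqrt(n) l, hence at
     most th s <= d/2. *)
  pose th := Num.min (1 / 2) (d / 2 / s).
  have th0 : 0 < th by rewrite lt_min; apply/andP; split; [lra|rewrite !divr_gt0].
  have th1 : th <= 1 / 2 by rewrite ge_min lexx.
  have thd : th * s <= d / 2 by rewrite -ler_pdivlMr// ge_min lexx orbT.
  pose x' := [tuple tnth x i + th * (tnth a i + l / 2 - tnth x i) | i < n].
  have Hx' : open_cube a l x'.
    move=> i; rewrite tnth_mktuple; have /andP[h1 h2] := Hx i.
    by apply/andP; split; nra.
  exists x' => //; apply: Hd; first exact/HO/sub_open_half_open_cube.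
  apply: (@le_lt_trans _ _ (Num.sqrt n%:R * (th * l))).
    apply: edist_le; first by rewrite mulr_ge0 ?ltW.
    move=> i; rewrite tnth_mktuple; have /andP[h1 h2] := Hx i.
    rewrite opprD addrA subrr sub0r normrN normrM (gtr0_norm th0) ler_pM2l//.
    by rewrite ler_norml; apply/andP; split; lra.
  rewrite /s in thd; move: thd; move: (Num.sqrt n%:R) => w; nra.
apply: ge_ereal_sup => _ [->|[_ [_ [[x Hx <-] [[y Hy <-] ->]]]]].
  by apply: ereal_sup_ubound; left.
apply/lee_addgt0Pr => e e0.
have e2 : 0 < e / 2 by rewrite divr_gt0.
have [x' Hx' dx] := near x _ Hx e2; have [y' Hy' dy] := near y _ Hy e2.
apply: (@le_trans _ _ ((edist (u x') (u y'))%:E + e%:E)%E).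
  rewrite -EFinD lee_fin.
  have := edist_triangle _ (u x) (u x') (u y).
  have := edist_triangle _ (u x') (u y') (u y).
  by rewrite (edistC _ (u y') (u y)) => ? ?; lra.
rewrite leeD2r//; apply: ereal_sup_ubound; right.
by exists (u x'), (u y'); split; [exists x'|split; [exists y'|]].
Qed.

End half_open_cube.

(** * Dyadic decomposition of open sets *)

Section dyadic.
Context {R : realType} {n : nat}.
Implicit Types (x y : n.-tuple R) (z : n.-tuple int) (k j : nat).

Definition dyadic_cell k z : set (n.-tuple R) :=
  half_open_cube [tuple (tnth z i)%:~R * 2 ^- k | i < n] (2 ^- k).

Definition dyadic_index k x : n.-tuple int :=
  [tuple Num.floor (2 ^+ k * tnth x i) | i < n].

(** Hence the cells of one generation partition the space. *)
Lemma dyadic_cellP k z x : dyadic_cell k z x <-> z = dyadic_index k x.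
Proof.
have p0 : 0 < 2 ^+ k :> R by rewrite exprn_gt0.
split=> [H|-> i].
  apply: eq_from_tnth => i; rewrite tnth_mktuple; apply/esym/floor_def.
  have := H i; rewrite !tnth_mktuple -{3}[2 ^- k]mul1r -mulrDl.
  by rewrite ler_pdivrMr// ltr_pdivlMr// ![tnth x i * _]mulrC intrD.
rewrite !tnth_mktuple -{3}[2 ^- k]mul1r -mulrDl.
rewrite ler_pdivrMr// ltr_pdivlMr// ![tnth x i * _]mulrC.
by rewrite -(@intrD _ _ 1) floor_itv.
Qed.

(** An integer m is at most floor(2^j w) exactly when m 2^(k-j) is at most floor(2^k w), so the fine
    index determines the coarse one. *)
Lemma dyadic_index_nested j k x y : (j <= k)%N ->
  dyadic_index k x = dyadic_index k y -> dyadic_index j x = dyadic_index j y.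
Proof.
move=> jk H; apply: eq_from_tnth => i; rewrite !tnth_mktuple.
have {}H : Num.floor (2 ^+ k * tnth x i) = Num.floor (2 ^+ k * tnth y i).
  by have := congr1 (fun z => tnth z i) H; rewrite !tnth_mktuple.
have E (m : int) (w : R) : (m <= Num.floor (2 ^+ j * w)) =
    (m * 2 ^+ (k - j) <= Num.floor (2 ^+ k * w)).
  rewrite !floor_ge_int intrM -{2}(subnK jk) exprD [2 ^+ (k - j) * _]mulrC.
  rewrite mulrAC rmorphXn/= ler_pM2r// exprn_gt0//.
apply/eqP; rewrite eq_le; apply/andP; split.
  by rewrite E -H -E.
by rewrite E H -E.
Qed.

Lemma dyadic_cell_small (G : set (n.-tuple R)) x : eopen G -> G x ->
  exists k, dyadic_cell k (dyadic_index k x) `<=` G.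
Proof.
move=> oG /oG[r [r0 Hr]].
have s0 : 0 < Num.sqrt n%:R + 1 :> R by rewrite ltr_wpDl// sqrtr_ge0.
(* As 2^(k+1) > k+1 > (sqrt(n) + 1)/r, the cells of generation k+1 have diameter less than r. *)
pose k := Num.truncn ((Num.sqrt n%:R + 1) / r).
have kr : (Num.sqrt n%:R + 1) / r < 2 ^+ k.+1.
  apply: (@lt_trans _ _ k.+1%:R); first exact: truncnS_gt.
  by rewrite -natrX ltr_nat ltn_expl.
have p0 : 0 < 2 ^+ k.+1 :> R by rewrite exprn_gt0.
exists k.+1 => y Hy; apply: Hr.
have /dyadic_cellP Hx : dyadic_index k.+1 x = dyadic_index k.+1 x by [].
apply: (@le_lt_trans _ _ (Num.sqrt n%:R * 2 ^- k.+1)).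
  apply: edist_le; first by rewrite invr_ge0 ltW.
  move=> i; have /andP[h1 h2] := Hx i; have /andP[h3 h4] := Hy i.
  by rewrite ler_norml; apply/andP; split; lra.
rewrite ltr_pdivrMr//; rewrite ltr_pdivrMr// in kr.
by rewrite mulrC; lra.
Qed.

Lemma dyadic_decomposition (G : set (n.-tuple R)) : eopen G ->
  exists F : (set (n.-tuple R))^nat,
    [/\ G = \bigcup_j F j, trivIset setT F &
     forall j, F j = set0 \/ exists a l, 0 < l /\ F j = half_open_cube a l].
Proof.
move=> oG.
(* P selects the maximal dyadic cells contained in G. *)
pose P k z := dyadic_cell k z `<=` G /\ forall j, (j < k)%N ->
  forall y, dyadic_cell k z y -> ~ (dyadic_cell j (dyadic_index j y) `<=` G).
(* The pairs (generation, index) are enumerated by their codes; codes of no maximal cell give the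
   empty set. *)
pose F (j : nat) := if (pickle_inv j : option (nat * n.-tuple int)) is Some (k, z)
  then (if `[< P k z >] then dyadic_cell k z else set0) else set0.
have Fin j x : F j x -> exists k z,
    [/\ pickle_inv j = Some (k, z), P k z & dyadic_cell k z x].
  rewrite /F; case: pickle_inv => [[k z]|//].
  by case: ifPn => [/asboolP Pkz xz|//]; exists k, z.
exists F; split.
- apply/seteqP; split => x.
    move=> Gx; have [k0 Hk0] := dyadic_cell_small _ _ oG Gx.
    pose Q k := `[< dyadic_cell k (dyadic_index k x) `<=` G >].
    have exQ : exists k, Q k by exists k0; apply/asboolP.
    case: (ex_minnP exQ) => k /asboolP Qk mink.
    exists (pickle (k, dyadic_index k x)) => //.
    rewrite /F pickleK_inv; case: asboolP => [_|nP]; first exact/dyadic_cellP.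
    (* A coarser cell in G around another point y of the cell is also the coarser cell around x,
       against the minimality of k. *)
    exfalso; apply: nP; split => // j jk y /dyadic_cellP xy Hy.
    have := dyadic_index_nested _ _ _ _ (ltnW jk) xy => xyj.
    have : Q j by apply/asboolP; rewrite xyj.
    by move=> /mink; rewrite leqNgt jk.
  by move=> [j _ /Fin[k [z [_ [+ _] xz]]]]; apply.
- move=> i j _ _ [x [/Fin[k [z [Ei [zG zP] xz]]] /Fin[k' [z' [Ej [zG' zP'] xz']]]]].
  have ez := xz; have ez' := xz'; move/dyadic_cellP in ez; move/dyadic_cellP in ez'.
  have := @pickle_invK (nat * n.-tuple int)%type i.
  have := @pickle_invK (nat * n.-tuple int)%type j.
  rewrite Ei Ej /= => <- <-.
  (* If the generations differ, the coarser cell contains x and lies in G, against the maximality of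
     the finer one. *)
  case: (ltngtP k k') => [kk|kk|kk].
  + by exfalso; apply: (zP' _ kk x xz'); rewrite -ez.
  + by exfalso; apply: (zP _ kk x xz); rewrite -ez'.
  + by rewrite ez ez' kk.
- move=> j; rewrite /F; case: pickle_inv => [[k z]|]; last by left.
  case: ifPn => _; last by left.
  right; exists [tuple (tnth z i)%:~R * 2 ^- k | i < n], (2 ^- k).
  by rewrite invr_gt0 exprn_gt0.
Qed.

End dyadic.

(** * Open sets and their measurability *)

Section eopen.
Context {R : realType} {n : nat}.
Implicit Types (x y : n.-tuple R) (U V S : set (n.-tuple R)).

Lemma eopen_bigcap_ord k (S : 'I_k -> set (n.-tuple R)) :
  (forall i, eopen (S i)) -> eopen [set x | forall i, S i x].
Proof.
move=> oS x Sx.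
have /choice[r Hr] : forall i, exists r : R, 0 < r /\ forall y, edist x y < r -> S i y.
  by move=> i; exact: oS.
have s0 : 0 < 1 + \sum_i (r i)^-1.
  rewrite ltr_pwDl// sumr_ge0// => i _; rewrite invr_ge0 ltW//; exact: (Hr i).1.
(* A positive number below every r_i, also for an empty family. *)
exists (1 + \sum_i (r i)^-1)^-1; split; first by rewrite invr_gt0.
move=> y xy i; have [ri0] := Hr i; apply.
apply: (lt_le_trans xy); rewrite -[leRHS]invrK lef_pV2 ?posrE ?invr_gt0//.
rewrite (bigD1 i)//= addrCA lerDl addr_ge0// sumr_ge0// => j _.
by rewrite invr_ge0 ltW//; exact: (Hr j).1.
Qed.

Lemma eopenI U V : eopen U -> eopen V -> eopen (U `&` V).
Proof.
move=> oU oV x [/oU[r [r0 Hr]] /oV[s [s0 Hs]]].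
exists (Num.min r s); split; first by rewrite lt_min r0.
by move=> y; rewrite lt_min => /andP[/Hr Uy /Hs].
Qed.

Lemma eopen_bigcup (U : (set (n.-tuple R))^nat) :
  (forall k, eopen (U k)) -> eopen (\bigcup_k U k).
Proof.
move=> oU x [k _ /oU[r [r0 Hr]]]; exists r; split => // y /Hr Uy.
by exists k.
Qed.

Lemma eopen_gt_tnth i (c : R) : eopen [set x : n.-tuple R | c < tnth x i].
Proof.
move=> x /= cx; exists (tnth x i - c); split; first by rewrite subr_gt0.
move=> y xy; have := le_lt_trans (ler_tnth_edist _ x y i) xy.
by rewrite ltr_norml => /andP[? ?]; lra.
Qed.

Lemma eopen_lt_tnth i (c : R) : eopen [set x : n.-tuple R | tnth x i < c].
Proof.
move=> x /= cx; exists (c - tnth x i); split; first by rewrite subr_gt0.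
move=> y xy; have := le_lt_trans (ler_tnth_edist _ x y i) xy.
by rewrite ltr_norml => /andP[? ?]; lra.
Qed.

Lemma eopen_open_cube (a : n.-tuple R) l : eopen (open_cube a l).
Proof.
rewrite (_ : open_cube a l = [set x | forall i,
   ([set x : n.-tuple R | tnth a i < tnth x i] `&`
    [set x | tnth x i < tnth a i + l]) x]).
  apply: (eopen_bigcap_ord _ (fun i => _ `&` _)) => i.
  by apply: eopenI; [exact: eopen_gt_tnth|exact: eopen_lt_tnth].
apply/seteqP; split => x /= H i; first by apply/andP; exact: (H i).
by have [-> ->] := H i.
Qed.

(** The dyadic decomposition writes U as a countable union of sets in the product sigma-algebra. *)
Lemma eopen_measurable U : eopen U -> measurable U.
Proof.
move=> /dyadic_decomposition[F [-> _ HF]]; apply: bigcup_measurable => j _.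
by have [->//|[a [l [_ ->]]]] := HF j; exact: measurable_half_open_cube.
Qed.

End eopen.

(** * Outer regularity of Lebesgue measure *)

Section regularity.
Context {R : realType} {n : nat} (mu : {measure set (n.-tuple R) -> \bar R}).
Hypothesis Lmu : is_lebesgue_measure mu.
Implicit Types (x y : n.-tuple R) (U V S : set (n.-tuple R)).

Let box (N : nat) : set (n.-tuple R) :=
  open_cube [tuple - N%:R | i < n] (2 * N%:R).

Let boxP N x : box N x <-> forall i, - N%:R < tnth x i < N%:R.
Proof.
split=> H i; have := H i; rewrite ?tnth_mktuple.
  by rewrite (_ : - N%:R + 2 * N%:R = N%:R :> R)//; ring.
by rewrite (_ : - N%:R + 2 * N%:R = N%:R :> R)//; ring.
Qed.

Let box_open N : eopen (box N).
Proof. exact: eopen_open_cube. Qed.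

Let box_lty N : (mu (box N) < +oo)%E.
Proof.
pose a : n.-tuple R := [tuple - N%:R | i < n].
pose b : n.-tuple R := [tuple N%:R | i < n].
apply: (@le_lt_trans _ _ (mu (closed_box a b))).
  apply: le_measure; rewrite ?inE.
  - by apply: eopen_measurable; exact: box_open.
  - exact: measurable_closed_box.
  by move=> x /boxP H i; rewrite !tnth_mktuple; have /andP[/ltW -> /ltW ->] := H i.
rewrite Lmu ?ltry// => i; rewrite !tnth_mktuple.
by apply: (@le_trans _ _ 0); rewrite ?oppr_le0.
Qed.

(* Symmetric under complement, hence a class that is seen to be a
   sigma-algebra; on each bounded box it expresses regularity of mu at S. *)
Let approx S := forall (N : nat) (e : R), 0 < e ->
  exists W : set (n.-tuple R) * set (n.-tuple R),
    [/\ eopen W.1, eopen W.2, S `<=` W.1, ~` S `<=` W.2 &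
    (mu (W.1 `&` W.2 `&` box N) <= e%:E)%E].

Let approx0 : approx set0.
Proof.
move=> N e e0; exists (set0, setT) => /=; split => //.
- by move=> x _; exists 1.
- by rewrite !set0I measure0 lee_fin ltW.
Qed.

Let approxC S : approx S -> approx (~` S).
Proof.
move=> aS N e e0; have [[U V] /= [oU oV SU SV m]] := aS N e e0.
by exists (V, U) => /=; split => //; [rewrite setCK|rewrite [V `&` U]setIC].
Qed.

(** The union is covered by all the first sets. Its complement may only be covered by a finite
    intersection of the second sets, to keep openness; the loss [T K] decreases to the empty set
    inside a box of finite measure, so it is below e/2 for some K. *)
Let approx_bigcup (S : (set (n.-tuple R))^nat) :
  (forall k, approx (S k)) -> approx (\bigcup_k S k).
Proof.
move=> aS N e e0.
have e20 : 0 < e / 2 by rewrite divr_gt0.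
have ek k : 0 < e / 2 / (2 ^ k.+1)%:R by rewrite divr_gt0// ltr0n expn_gt0.
have /choice[W HW] : forall k, exists W : set (n.-tuple R) * set (n.-tuple R),
    [/\ eopen W.1, eopen W.2, S k `<=` W.1, ~` S k `<=` W.2 &
    (mu (W.1 `&` W.2 `&` box N) <= (e / 2 / (2 ^ k.+1)%:R)%:E)%E].
  by move=> k; exact: aS.
pose U := \bigcup_k (W k).1.
have oU : eopen U by apply: eopen_bigcup => k; case: (HW k).
pose T K := (U `\` \bigcup_(k in `I_K) (W k).1) `&` box N.
have mT K : measurable (T K).
  apply: measurableI; last by apply: eopen_measurable; exact: box_open.
  apply: measurableD; first exact: eopen_measurable.
  apply: bigcup_measurable => k _; apply: eopen_measurable; case: (HW k) => //.
have T0 : \bigcap_K T K = set0.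
  apply/seteqP; split => // x H; have [[[k _ Hk] _] _] := H 0%N I.
  have [[_ +] _] := H k.+1 I; apply; exists k => //=.
have cT : (mu \o T) K @[K --> \oo] --> mu (\bigcap_K T K).
  apply: nonincreasing_cvg_mu => //.
  - apply: (le_lt_trans _ (box_lty N)); apply: le_measure; rewrite ?inE//.
    + by apply: eopen_measurable; exact: box_open.
    + by move=> x [].
  - by rewrite T0.
  - move=> i j ij; rewrite subsetEset => x [[Ux nx] bx]; split=> //; split=> //.
    by move=> [k /= ki Hk]; apply: nx; exists k => //=; exact: leq_trans ki ij.
have [K HK] : exists K, (mu (T K) <= (e / 2)%:E)%E.
  move: cT; rewrite T0 measure0 => /fine_cvgP[[N1 _ finT]].
  move=> /cvgrPdist_le /(_ _ e20)[N2 _ cF].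
  exists (maxn N1 N2).
  have fT : mu (T (maxn N1 N2)) \is a fin_num := finT (maxn N1 N2) (leq_maxl _ _).
  have := cF (maxn N1 N2) (leq_maxr _ _).
  rewrite /= sub0r normrN => H; rewrite -(fineK fT) lee_fin.
  by apply: (le_trans (ler_norm _)).
pose V := [set x | forall k : 'I_K, (W k).2 x].
have oV : eopen V by apply: eopen_bigcap_ord => k; case: (HW k).
exists (U, V) => /=; split => //.
- by move=> x [k _ Sx]; exists k => //; case: (HW k) => _ _ + _ _; exact.
- move=> x Sx k; case: (HW k) => _ _ _ + _; apply => Skx.
  by apply: Sx; exists k.
have mW k : measurable ((W k).1 `&` (W k).2 `&` box N).
  case: (HW k) => o1 o2 _ _ _; apply: eopen_measurable.
  by apply: eopenI => //; exact: eopenI.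
apply: (@le_trans _ _ (mu (T K `|` \bigcup_k ((W k).1 `&` (W k).2 `&` box N)))).
  apply: le_measure; rewrite ?inE.
  - by apply: eopen_measurable; apply: eopenI => //; exact: eopenI.
  - by apply: measurableU => //; exact: bigcup_measurable.
  move=> x [[Ux Vx] bx].
  have [[k /= kK Hk]|nk] := pselect ((\bigcup_(k in `I_K) (W k).1) x).
    right; exists k => //; split => //; split => //.
    exact: (Vx (Ordinal kK)).
  by left.
apply: (le_trans (measureU2 _ _ _)) => //; first exact: bigcup_measurable.
rewrite (_ : e = e / 2 + e / 2); last by field.
rewrite EFinD; apply: leeD => //.
apply: (le_trans (measure_sigma_subadditive mu mW _ (@subset_refl _ _))).
  exact: bigcup_measurable.
apply: (le_trans _ (epsilon_trick0 xpredT (ltW e20))).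
by apply: lee_nneseries => [k _ _|k _]; [exact: measure_ge0|case: (HW k)].
Qed.

Let approx_sigma : sigma_algebra setT approx.
Proof.
split; [exact: approx0| |exact: approx_bigcup].
by move=> A aA; rewrite setTD; exact: approxC.
Qed.

(** The two open half-spaces overlap in a slab of width d, whose part in the box has volume at most
    d times the other side lengths. *)
Let approx_ray i (c : R) : approx [set x : n.-tuple R | c < tnth x i].
Proof.
move=> N e e0.
have p0 : 0 < \prod_(j < n | j != i) (2 * N%:R) + 1 :> R.
  by rewrite ltr_wpDl// prodr_ge0// => j _; rewrite mulr_ge0.
pose d := e / (\prod_(j < n | j != i) (2 * N%:R) + 1).
have d0 : 0 < d by rewrite divr_gt0.
exists ([set x | c < tnth x i], [set x | tnth x i < c + d]) => /=; split => //.
- exact: eopen_gt_tnth.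
- exact: eopen_lt_tnth.
- by move=> x /= /negP; rewrite -leNgt => /le_lt_trans; apply; rewrite ltrDl.
pose a : n.-tuple R := [tuple (if j == i then c else - N%:R) | j < n].
pose b : n.-tuple R := [tuple (if j == i then c + d else N%:R) | j < n].
apply: (@le_trans _ _ (mu (closed_box a b))).
  apply: le_measure; rewrite ?inE.
  - apply: eopen_measurable; apply: eopenI => //; apply: eopenI.
      exact: eopen_gt_tnth.
    exact: eopen_lt_tnth.
  - exact: measurable_closed_box.
  move=> x [[/= /ltW h1 /ltW h2] /boxP bx] j; rewrite !tnth_mktuple.
  case: eqVneq => [->|_]; first by rewrite h1.
  by have /andP[/ltW -> /ltW ->] := bx j.
rewrite Lmu => [|j]; last first.
  rewrite !tnth_mktuple; case: ifP => _; first by rewrite lerDl ltW.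
  by apply: (@le_trans _ _ 0); rewrite ?oppr_le0.
rewrite lee_fin (bigD1 i)//= !tnth_mktuple eqxx (addrC c) addrK.
rewrite (eq_bigr (fun=> 2 * N%:R)); last first.
  by move=> j ji; rewrite !tnth_mktuple (negbTE ji); ring.
rewrite /d mulrAC ler_pdivrMr// ler_pM2l// lerDl//.
Qed.

(** Two generation arguments: the product sigma-algebra is generated by coordinate preimages of
    Borel sets, and the Borel sets by open rays. *)
Let measurable_approx S : measurable S -> approx S.
Proof.
apply: (@smallest_sub _ _ _ approx) => //.
rewrite -bigcup_seq => _ [i _ [B mB <-]]; rewrite setTI.
have {}mB : (@RGenOInfty.G R).-sigma.-measurable B.
  by rewrite -RGenOInfty.measurableE.
move: B mB.
apply: (@smallest_sub _ _ _ [set B : set R | approx ((@tnth n R)^~ i @^-1` B)]).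
  split=> /=.
  - by rewrite preimage_set0.
  - by move=> A aA; rewrite setTD preimage_setC; exact: approxC.
  - by move=> A aA; rewrite preimage_bigcup; exact: approx_bigcup.
move=> _ [c ->] /=.
rewrite (_ : _ @^-1` _ = [set x : n.-tuple R | c < tnth x i]) ?approx_ray//.
by apply/seteqP; split => x /=; rewrite in_itv/= andbT.
Qed.

(** Approximation in the k-th box is made with error e/2^(k+1). The part of the union of the W_k.1
    in their boxes that lies outside S is covered by the overlaps W_k.1, W_k.2, whose measures sum
    to at most e. *)
Lemma lebesgue_outer_regular S (e : R) : measurable S -> 0 < e ->
  exists U, [/\ eopen U, S `<=` U & (mu U <= mu S + e%:E)%E].
Proof.
move=> mS e0; have aS := measurable_approx _ mS.
have ek k : 0 < e / (2 ^ k.+1)%:R by rewrite divr_gt0// ltr0n expn_gt0.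
have /choice[W HW] : forall k, exists W : set (n.-tuple R) * set (n.-tuple R),
    [/\ eopen W.1, eopen W.2, S `<=` W.1, ~` S `<=` W.2 &
    (mu (W.1 `&` W.2 `&` box k) <= (e / (2 ^ k.+1)%:R)%:E)%E].
  by move=> k; exact: aS.
have mW k : measurable ((W k).1 `&` (W k).2 `&` box k).
  case: (HW k) => o1 o2 _ _ _; apply: eopen_measurable.
  by apply: eopenI => //; exact: eopenI.
have oU : eopen (\bigcup_k ((W k).1 `&` box k)).
  by apply: eopen_bigcup => k; apply: eopenI => //; case: (HW k).
exists (\bigcup_k ((W k).1 `&` box k)); split => //.
  move=> x Sx.
  pose r := \sum_(i < n) `|tnth x i|.
  exists (Num.truncn r).+1 => //; split.
    by case: (HW (Num.truncn r).+1) => _ _ + _ _; exact.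
  apply/boxP => i; rewrite -ltr_norml.
  apply: (le_lt_trans _ (truncnS_gt _)); rewrite /r (bigD1 i)//= lerDl.
  by rewrite sumr_ge0.
apply: (@le_trans _ _ (mu (S `|` \bigcup_k ((W k).1 `&` (W k).2 `&` box k)))).
  apply: le_measure; rewrite ?inE.
  - exact: eopen_measurable.
  - by apply: measurableU => //; exact: bigcup_measurable.
  move=> x [k _ [Wx bx]].
  have [Sx|nSx] := pselect (S x); [by left|right; exists k => //].
  by split=> //; split=> //; case: (HW k) => _ _ _ + _; exact.
apply: (le_trans (measureU2 _ _ _)) => //; first exact: bigcup_measurable.
apply: leeD => //.
apply: (le_trans (measure_sigma_subadditive mu mW _ (@subset_refl _ _))).
  exact: bigcup_measurable.
apply: (le_trans _ (epsilon_trick0 xpredT (ltW e0))).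
by apply: lee_nneseries => [k _ _|k _]; [exact: measure_ge0|case: (HW k)].
Qed.

Lemma outer_leb_open (O E : set (n.-tuple R)) (v : R) : eopen O -> E `<=` O ->
  (outer_leb mu E < v%:E)%E ->
  exists G, [/\ eopen G, E `<=` G, G `<=` O & (mu G <= v%:E)%E].
Proof.
move=> oO EO /ereal_inf_lt[_ [S [mS ES] <-] mSv].
have mSfin : mu S \is a fin_num.
  by rewrite ge0_fin_numE ?measure_ge0// (lt_trans mSv)// ltry.
have e0 : 0 < v - fine (mu S) by rewrite subr_gt0 -lte_fin fineK.
have [U [oU SU mU]] := lebesgue_outer_regular _ _ mS e0.
exists (U `&` O); split.
- exact: eopenI.
- by move=> x Ex; split; [exact/SU/ES|exact: EO].
- by move=> x [].
apply: (@le_trans _ _ (mu U)).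
  apply: le_measure; rewrite ?inE; last by move=> x [].
    by apply: eopen_measurable; exact: eopenI.
  exact: eopen_measurable.
apply: (le_trans mU); rewrite -{1}(fineK mSfin) -EFinD lee_fin.
by rewrite addrC subrK.
Qed.

End regularity.

(** * Bounding the content by summing over cubes *)

Section content_bound.
Context {R : realType} {n m : nat}.
Variables (mu : {measure set (n.-tuple R) -> \bar R}) (kappa : R)
  (O : set (n.-tuple R)) (A : R -> R) (u : n.-tuple R -> m.-tuple R)
  (g : 'I_m -> 'I_n -> n.-tuple R -> R).
Hypotheses (n1 : (1 <= n)%N) (Lmu : is_lebesgue_measure mu)
  (k0 : 0 < kappa) (Hk : @kappa_prop R n m mu kappa) (oO : eopen O)
  (yA : young_fun A) (C1 : cond_C1 n A) (C2 : cond_C2 A) (C3 : cond_C3 n A)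
  (uV : inV1A mu A O u g) (uc : econt_on O u).

Let f (lam : R) x := (A (gradnorm g x / lam))%:E.

Let f_ge0 lam x : 0 < lam -> (0 <= f lam x)%E.
Proof.
move=> l0; rewrite lee_fin; case: yA => _ [+ _]; apply.
by rewrite divr_ge0 ?sqrtr_ge0// ltW.
Qed.

Let measurable_f lam : 0 < lam -> measurable_fun O (f lam).
Proof.
move=> l0; apply/measurable_EFinP.
have mg : measurable_fun O (fun x => gradnorm g x / lam).
  apply: measurable_funM => //.
  rewrite (_ : gradnorm g = fun x => (\sum_(i < m) \sum_(j < n) g i j x ^+ 2) `^ 2^-1).
    apply: (measurableT_comp (measurable_powR _)).
    apply: measurable_sum => i; apply: measurable_sum => j.
    by apply: measurable_funX; case: uV => -[_ [+ _]] _ => /(_ i j)[].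
  apply/funext => x; rewrite powR12_sqrt// sumr_ge0// => i _.
  by rewrite sumr_ge0// => j _; exact: sqr_ge0.
rewrite (_ : (fun x => _) = (fun t => A (Num.max 0 t)) \o (fun x => gradnorm g x / lam)).
  exact: (measurableT_comp (young_fun_measurable _ yA) mg).
by apply/funext => x /=; rewrite max_r// divr_ge0 ?sqrtr_ge0// ltW.
Qed.

(** The diameter of a cube of side l. *)
Let dia (l : R) := l * Num.sqrt n%:R.

Let dia_gt0 l : 0 < l -> 0 < dia l.
Proof. by move=> l0; rewrite mulr_gt0// sqrtr_gt0 ltr0n. Qed.

(** The hypothesis on kappa, brought to real numbers: its right side is finite, which excludes an
    infinite diameter or an infinite value of B. *)
Lemma cube_oscillation a (l lam : R) : 0 < l -> half_open_cube a l `<=` O ->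
  0 < lam -> (\int[mu]_(x in O) f lam x <= 1)%E ->
  exists D b : R, [/\ 0 <= D, ediam (u @` open_cube a l) = D%:E,
    assocB n A (D / (kappa * lam * dia l)) = b%:E &
    ((dia l ^+ n / kappa * b)%:E <= \int[mu]_(x in half_open_cube a l) f lam x)%E].
Proof.
move=> l0 aO lam0 Hlam.
have oaO : open_cube a l `<=` O by move=> x /sub_open_half_open_cube /aO.
have foo : (\int[mu]_(x in open_cube a l) f lam x < +oo)%E.
  apply: (@le_lt_trans _ _ 1%E); last exact: ltry.
  apply: le_trans Hlam; apply: ge0_le_integral_nonmeasurable => // x _; exact: f_ge0.
have := Hk O A u g oO yA C1 C2 C3 uV uc a l l0 oaO lam lam0 foo.
rewrite /= -/(dia l) => H.
have d0 : 0 < dia l by exact: dia_gt0.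
have p0 : 0 < dia l ^+ n / kappa by rewrite divr_gt0// exprn_gt0.
have q0 : 0 < kappa * lam * dia l by rewrite mulr_gt0// mulr_gt0.
have := ediam_ge0 _ (u @` open_cube a l); move: H.
case E : (ediam (u @` open_cube a l)) => [D| |] //=; last first.
  by rewrite gt0_mulye ?lte_fin ?invr_gt0//= gt0_muley ?lte_fin// => /le_lt_trans/(_ foo).
move=> H D0.
have t0 : 0 <= D / (kappa * lam * dia l) by rewrite divr_ge0// ltW.
have := assocB_ge0 n A n1 yA _ t0; move: H.
case EB : (assocB n A (D / (kappa * lam * dia l))) => [b| |] //=; last first.
  by rewrite gt0_muley ?lte_fin// => /le_lt_trans/(_ foo).
move=> H b0; exists D, b; split => //.
rewrite EFinM; apply: (le_trans H).
by apply: ge0_le_integral_nonmeasurable => [|x _|x _|//];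
  [exact: sub_open_half_open_cube|exact: f_ge0|exact: f_ge0].
Qed.

(** The first summand suffices when t <= s; otherwise [assocB_scale] with c = t/s gives (t/s)^n / W
    <= b, and the second suffices. *)
Lemma assocB_pow_le s t b W : 0 < s -> 0 < W -> 0 <= t ->
  (W^-1%:E <= assocB n A s)%E -> assocB n A t = b%:E ->
  t ^+ n <= s ^+ n + b * W * s ^+ n.
Proof.
move=> s0 W0 t0 Ws Eb.
have b0 : 0 <= b by rewrite -lee_fin -Eb assocB_ge0.
have sn0 : 0 < s ^+ n by rewrite exprn_gt0.
have [ts|st] := leP t s.
  have h : t ^+ n <= s ^+ n by rewrite lerXn2r// nnegrE ltW.
  by rewrite (le_trans h)// lerDl mulr_ge0// ?mulr_ge0// ltW.
have c1 : 1 <= t / s by rewrite ler_pdivlMr// mul1r ltW.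
have := assocB_scale n A n1 yA _ _ c1 (ltW s0).
rewrite divfK ?gt_eqF// Eb => H.
have : (((t / s) ^+ n)%:E * W^-1%:E <= b%:E)%E.
  apply: le_trans H; apply: lee_wpmul2l => //.
  by rewrite lee_fin exprn_ge0// divr_ge0// ltW.
rewrite -EFinM lee_fin ler_pdivrMr// expr_div_n ler_pdivrMr// => h.
by rewrite (le_trans h)// lerDr ltW.
Qed.

Lemma natr_powR_half : n%:R `^ (n%:R / 2) = Num.sqrt n%:R ^+ n :> R.
Proof.
by rewrite mulrC powRrM powR12_sqrt// powR_mulrn// sqrtr_ge0.
Qed.

Lemma hcontent_open_bound (G E : set (n.-tuple R)) (lam s W v : R) :
  eopen G -> G `<=` O -> E `<=` G -> 0 < lam -> 0 < s -> 0 < W ->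
  (\int[mu]_(x in O) f lam x <= 1)%E ->
  (W^-1%:E <= assocB n A s)%E ->
  (mu G <= v%:E)%E -> Num.sqrt n%:R ^+ n * v <= kappa * W ->
  (hcontent n (u @` E) <= (2 * kappa ^+ n.+1 * lam ^+ n * (W * s ^+ n))%:E)%E.
Proof.
move=> oG GO EG lam0 s0 W0 Hlam Ws mG vW.
have [F [GF tF HF]] := dyadic_decomposition _ oG.
have mF j : measurable (F j).
  by have [->//|[a [l [_ ->]]]] := HF j; exact: measurable_half_open_cube.
have FG j : F j `<=` G by rewrite GF => x Fx; exists j.
have FO j : F j `<=` O by move=> x /FG /GO.
pose a j := (\int[mu]_(x in F j) f lam x)%E.
have a0 j : (0 <= a j)%E by apply: integral_ge0 => x _; exact: f_ge0.
pose P : R := Num.sqrt n%:R ^+ n.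
have P0 : 0 < P by rewrite exprn_gt0// sqrtr_gt0 ltr0n.
pose c : R := kappa ^+ n * lam ^+ n * s ^+ n.
have c0 : 0 < c by rewrite !mulr_gt0// exprn_gt0.
have m0 j : (0 <= mu (F j))%E by exact: measure_ge0.
have afin j : a j \is a fin_num.
  rewrite ge0_fin_numE//; apply: (@le_lt_trans _ _ 1%E); last exact: ltry.
  apply: le_trans Hlam; apply: ge0_le_integral_nonmeasurable => // x _; exact: f_ge0.
have mfin j : mu (F j) \is a fin_num.
  rewrite ge0_fin_numE//; apply: (@le_lt_trans _ _ v%:E); last exact: ltry.
  by apply: le_trans mG; apply: le_measure; rewrite ?inE//; exact: eopen_measurable.
(* The n-th power of the diameter is (kappa lam dia)^n t^n, and t^n is split by [assocB_pow_le]: the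
   volume pays for the first summand, the energy a_j for the second. *)
have key j : (ediam (u @` F j) ^+ n <=
    c%:E * (P%:E * mu (F j) + (W * kappa)%:E * a j))%E.
  have := FO j; have := mfin j; have := afin j; rewrite /a.
  have [->|[x [l [l0 ->]]]] := HF j.
    move=> _ _ _; rewrite image_set0.
    have -> : ediam (@set0 (m.-tuple R)) = 0%E.
      apply/eqP; rewrite eq_le ediam_ge0 andbT; apply: ge_ereal_sup.
      by move=> _ [->//|[p [q [[]]]]].
    have /eqP -> : ((0 : \bar R) ^+ n == 0)%E by rewrite expe_eq0 n1 eqxx.
    by rewrite measure0 integral_set0 !mule0 adde0 mule0.
  move=> afinj mfinj xO.
  have [D [b [D0 ED Eb Hb]]] := cube_oscillation _ _ _ l0 xO lam0 Hlam.
  have := le_ediam_half_open_cube _ _ _ _ _ l0 xO uc; rewrite ED => hD.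
  have d0 : 0 < dia l by exact: dia_gt0.
  set t := D / (kappa * lam * dia l) in Eb.
  have q0 : 0 < kappa * lam * dia l by rewrite mulr_gt0// mulr_gt0.
  have t0 : 0 <= t by rewrite divr_ge0// ltW.
  have ht := assocB_pow_le _ _ _ _ s0 W0 t0 Ws Eb.
  have hl := lebesgue_half_open_cube_ge mu x l Lmu l0.
  move: Hb hl; rewrite -(fineK afinj) -(fineK mfinj).
  set aj := fine (integral _ _ _); set mj := fine (mu _) => Hb hl.
  rewrite !lee_fin in Hb hl.
  apply: (@le_trans _ _ (D%:E ^+ n)%E).
    have := ediam_ge0 _ (u @` half_open_cube x l); move: hD.
    case: (ediam _) => [D'| |]//; rewrite !lee_fin => D'D D'0.
    by rewrite -!EFin_expe lee_fin lerXn2r// nnegrE.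
  rewrite -EFin_expe -!EFinM lee_fin.
  have -> : D ^+ n = kappa ^+ n * lam ^+ n * (dia l ^+ n * t ^+ n).
    have {1}-> : D = kappa * lam * dia l * t by rewrite mulrC divfK// gt_eqF.
    by move: (dia l) (t) => x1 x2; rewrite !exprMn mulrA.
  rewrite /c -[leRHS]mulrA ler_pM2l ?mulr_gt0 ?exprn_gt0//.
  have dn0 : 0 <= dia l ^+ n by rewrite exprn_ge0// ltW.
  apply: (le_trans (ler_wpM2l dn0 ht)).
  have h1 : dia l ^+ n * b <= kappa * aj.
    by move: Hb; rewrite mulrAC ler_pdivrMr// [aj * _]mulrC.
  have h2 : dia l ^+ n <= P * mj.
    by rewrite /dia exprMn mulrC ler_pM2l.
  rewrite [leLHS](_ : _ = s ^+ n * (dia l ^+ n + W * (dia l ^+ n * b))); last by ring.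
  rewrite ler_pM2l ?exprn_gt0// lerD// -mulrA ler_pM2l//.
apply: (@le_trans _ _ (\sum_(j <oo) ediam (u @` F j) ^+ n)%E).
  apply: ereal_inf_lbound; exists (fun j => u @` F j); split => //.
  by move=> _ [x /EG + <-]; rewrite GF => -[j _ Fx]; exists j => //; exists x.
apply: (@le_trans _ _ (\sum_(j <oo) (c%:E * (P%:E * mu (F j) + (W * kappa)%:E * a j)))%E).
  by apply: lee_nneseries => [j _ _|j _//]; rewrite expe_ge0// ediam_ge0.
have Wk0 : 0 < W * kappa by rewrite mulr_gt0.
have h1 j : (0 <= P%:E * mu (F j))%E by rewrite mule_ge0// lee_fin ltW.
have h2 j : (0 <= (W * kappa)%:E * a j)%E by rewrite mule_ge0// lee_fin ltW.
rewrite nneseriesZl; last by move=> j _; rewrite adde_ge0.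
rewrite nneseriesD// !nneseriesZl//.
have -> : (\sum_(j <oo) mu (F j) = mu G)%E.
  rewrite [in RHS]GF measure_bigcup//.
  by apply: eq_eseriesl => j; rewrite in_setT.
have -> : (\sum_(j <oo) a j = \int[mu]_(x in G) f lam x)%E.
  rewrite [in RHS]GF ge0_integral_bigcup//.
  - apply: measurable_funS (measurable_f _ lam0); first exact: eopen_measurable.
    by rewrite -GF.
  - by move=> x _; exact: f_ge0.
have hG : (\int[mu]_(x in G) f lam x <= 1)%E.
  by apply: le_trans Hlam; apply: ge0_le_integral_nonmeasurable => // x _; exact: f_ge0.
apply: (@le_trans _ _ (c%:E * (P%:E * v%:E + (W * kappa)%:E * 1))%E).
  apply: lee_wpmul2l; first by rewrite lee_fin ltW.
  by apply: leeD; apply: lee_wpmul2l; rewrite // lee_fin ltW.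
rewrite mule1 (_ : (c%:E * _)%E = (c * (P * v + W * kappa))%:E)// lee_fin.
(* The factor 2 comes from bounding both the volume term and the energy term by kappa W. *)
rewrite (_ : 2 * _ * _ * _ = c * (kappa * W + W * kappa)); last first.
  by rewrite /c exprS; ring.
by rewrite ler_pM2l// lerD2r.
Qed.

Lemma orlicz_norm_lt d : (orlicz_norm mu A O (gradnorm g) < d%:E)%E ->
  exists lam, [/\ 0 < lam, lam < d & (\int[mu]_(x in O) f lam x <= 1)%E].
Proof.
move=> /ereal_inf_lt[_ [lam [lam0 Hlam] <-]]; rewrite lte_fin => lamd.
exists lam; split => //; apply: le_trans Hlam.
apply: ge0_le_integral_nonmeasurable => // x _; rewrite ?f_ge0//.
  by rewrite ger0_norm ?sqrtr_ge0// f_ge0.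
by rewrite ger0_norm ?sqrtr_ge0.
Qed.

(** Here u is constant on each dyadic cube of the domain: a positive diameter D would, as lam tends
    to 0, make the argument of B arbitrarily large while the energy stays at most 1, against the
    growth of B. Countably many sets of diameter 0 then cover the image. *)
Lemma hcontent_norm0 (E : set (n.-tuple R)) : E `<=` O ->
  orlicz_norm mu A O (gradnorm g) = 0%E -> (hcontent n (u @` E) <= 0)%E.
Proof.
move=> EO N0.
have small d : 0 < d -> exists lam,
    [/\ 0 < lam, lam < d & (\int[mu]_(x in O) f lam x <= 1)%E].
  by move=> d0; apply: orlicz_norm_lt; rewrite N0 lte_fin.
have [F [GF tF HF]] := dyadic_decomposition _ oO.
have FO j : F j `<=` O by rewrite GF => x Fx; exists j.
apply: (@le_trans _ _ (\sum_(j <oo) ediam (u @` F j) ^+ n)%E).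
  apply: ereal_inf_lbound; exists (fun j => u @` F j); split => //.
  by move=> _ [x /EO + <-]; rewrite GF => -[j _ Fx]; exists j => //; exists x.
rewrite eseries0// => j _ _; apply/eqP; rewrite expe_eq0 n1/= eq_le ediam_ge0 andbT.
have := FO j; have [->|[x [l [l0 ->]]]] := HF j.
  by move=> _; rewrite image_set0; apply: ge_ereal_sup => _ [->//|[p [q [[]]]]].
move=> xO; apply: (le_trans (le_ediam_half_open_cube _ _ _ _ _ l0 xO uc)).
have [lam1 [lam10 _ Hlam1]] := small 1 ltr01.
have [D [_ [D0 ED _ _]]] := cube_oscillation _ _ _ l0 xO lam10 Hlam1.
rewrite ED lee_fin leNgt; apply/negP => Dp.
have d0 : 0 < dia l by exact: dia_gt0.
have dn0 : 0 < dia l ^+ n by rewrite exprn_gt0.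
(* With this constant and t >= 1, the left side of the kappa inequality is at least 2, while the
   energy is at most 1. *)
have [t0 t0p Ht0] := assocB_growth n A n1 yA C1 C2 (2 * kappa / dia l ^+ n).
pose t1 := Num.max t0 1.
have t10 : 0 < t1 by rewrite lt_max ltr01 orbT.
have kd0 : 0 < kappa * dia l * t1 by rewrite mulr_gt0// mulr_gt0.
have [lam [lam0 lamd Hlam]] := small _ (divr_gt0 Dp kd0).
have [D' [b [_ ED' Eb Hb]]] := cube_oscillation _ _ _ l0 xO lam0 Hlam.
move: ED'; rewrite ED => -[DD]; rewrite -{}DD in Eb.
have q0 : 0 < kappa * lam * dia l by rewrite mulr_gt0// mulr_gt0.
have tt1 : t1 <= D / (kappa * lam * dia l).
  rewrite ler_pdivlMr//; move: lamd; rewrite ltr_pdivlMr// => /ltW.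
  by apply: le_trans; rewrite le_eqVlt; apply/orP; left; apply/eqP; ring.
move: tt1; rewrite ge_max => /andP[tt0 tt1].
have := Ht0 _ tt0; rewrite Eb lee_fin => Hb2.
have Hb3 : dia l ^+ n / kappa * b <= 1.
  rewrite -lee_fin; apply: (le_trans Hb); apply: le_trans Hlam.
  by apply: ge0_le_integral_nonmeasurable => // y _; exact: f_ge0.
have tn1 : 1 <= (D / (kappa * lam * dia l)) ^+ n by rewrite exprn_ege1.
move: Hb2 Hb3; move: ((D / _) ^+ n) tn1 => z z1.
have q : 0 < 2 * kappa / dia l ^+ n by rewrite divr_gt0// mulr_gt0.
move=> h1; rewrite mulrAC ler_pdivrMr// mul1r => h2.
have h3 : 2 * kappa / dia l ^+ n <= b.
  by apply: le_trans h1; rewrite ler_peMr// ltW.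
move: h3; rewrite ler_pdivrMr// mulrC => h3.
by move: h2; rewrite mulrC => /(le_trans h3) h; have := k0; lra.
Qed.

End content_bound.

(** * Degenerate cases and passage to the limit *)

Theorem theorem3p6 (R : realType) (n m : nat)
  (mu : {measure set (n.-tuple R) -> \bar R}) (kappa : R)
  (O : set (n.-tuple R)) (A : R -> R) (u : n.-tuple R -> m.-tuple R)
  (g : 'I_m -> 'I_n -> n.-tuple R -> R) :
  (1 <= n)%N -> (n <= m)%N ->
  is_lebesgue_measure mu ->
  0 < kappa -> @kappa_prop R n m mu kappa ->
  eopen O ->
  young_fun A -> cond_C1 n A -> cond_C2 A -> cond_C3 n A ->
  inV1A mu A O u g -> econt_on O u ->
  forall E : set (n.-tuple R), E `<=` O ->
    (hcontent n (u @` E)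
     <= (2 * kappa ^+ n.+1)%:E * (orlicz_norm mu A O (gradnorm g)) ^+ n
        * PhiB n A (outer_leb mu E * (n%:R `^ (n%:R / 2) / kappa)%:E))%E.
Proof.
move=> n1 nm Lmu k0 Hk oO yA C1 C2 C3 uV uc E EO.
pose P : R := Num.sqrt n%:R ^+ n.
have P0 : 0 < P by rewrite exprn_gt0// sqrtr_gt0 ltr0n.
pose K : R := 2 * kappa ^+ n.+1.
have K0 : 0 < K by rewrite mulr_gt0// exprn_gt0.
rewrite natr_powR_half -/P -/K.
set N := orlicz_norm _ _ _ _; set h := hcontent _ _; set L := outer_leb _ _.
have N0 : (0 <= N)%E.
  by apply: le_ereal_inf_tmp => _ [l [l0 _] <-]; rewrite lee_fin ltW.
have L0 : (0 <= L)%E.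
  by apply: le_ereal_inf_tmp => _ [F _ <-]; exact: measure_ge0.
(* The strict inequalities leave room for an admissible lam < d and for an open G containing E with
   measure at most kappa W / P. *)
have bound d W s : (N < d%:E)%E -> (L < (kappa * W / P)%:E)%E -> 0 < W -> 0 < s ->
    (W^-1%:E <= assocB n A s)%E -> (h <= (K * d ^+ n * (W * s ^+ n))%:E)%E.
  move=> Nd LW W0 s0 Ws.
  have [lam [lam0 lamd Hlam]] := orlicz_norm_lt _ _ _ _ yA _ Nd.
  have [G [oG EG GO mG]] := outer_leb_open _ Lmu _ _ _ oO EO LW.
  have := hcontent_open_bound _ _ _ _ _ _ n1 Lmu k0 Hk oO yA C1 C2 C3 uV uc
    _ _ _ _ _ _ oG GO EG lam0 s0 W0 Hlam Ws mG.
  rewrite mulrC divfK ?gt_eqF// lexx => /(_ isT)/le_trans; apply.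
  rewrite lee_fin -/K ler_pM2r ?mulr_gt0 ?exprn_gt0// ler_pM2l// lerXn2r// ?nnegrE ltW//.
  exact: lt_trans lamd.
(* By the convention that 0 times infinity is 0, the right side vanishes here even for E of infinite
   measure, so the content itself must be 0. *)
have [Neq0|Nn0] := eqVneq N 0%E.
  rewrite Neq0; have /eqP -> : ((0 : \bar R) ^+ n == 0)%E by rewrite expe_eq0 n1 eqxx.
  rewrite mule0 mul0e.
  exact: (hcontent_norm0 _ _ _ _ _ _ n1 k0 Hk oO yA C1 C2 C3 uV uc _ EO Neq0).
have Np : (0 < N)%E by rewrite lt_neqAle eq_sym Nn0.
have Noo : (N < +oo)%E by case: uV.
have [r Er r0] : exists2 r, N = r%:E & 0 < r.
  have Nfin : N \is a fin_num by rewrite ge0_fin_numE.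
  by exists (fine N); rewrite -?lte_fin fineK.
rewrite Er -EFin_expe -EFinM.
have Krn0 : 0 < K * r ^+ n by rewrite mulr_gt0// exprn_gt0.
have Pk0 : 0 < P / kappa by rewrite divr_gt0.
have [Loo|Lfin] := eqVneq L +oo%E.
  by rewrite Loo gt0_mulye ?lte_fin//= gt0_muley ?lte_fin// leey.
have [v Ev v0] : exists2 v, L = v%:E & 0 <= v.
  have Lf : L \is a fin_num by rewrite ge0_fin_numE// ltey.
  by exists (fine L); [rewrite fineK|exact: fine_ge0].
rewrite Ev /=; case: eqVneq => [W0|Wn0].
  rewrite mule0; apply/lee_addgt0Pr => e e0; rewrite add0e.
  (* With W = 1/(M s^n), where B(s) >= M s^n, the bound K (r+1)^n W s^n is exactly e. *)
  pose M := K * (r + 1) ^+ n / e.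
  have r10 : 0 < r + 1 by rewrite addr_gt0.
  have M0 : 0 < M by rewrite divr_gt0// mulr_gt0// exprn_gt0.
  have [s s0 Hs] := assocB_growth n A n1 yA C1 C2 M.
  have sn0 : 0 < s ^+ n by rewrite exprn_gt0.
  have veq0 : v = 0.
    by apply/eqP; move/eqP: W0; rewrite mulf_eq0 (gt_eqF Pk0) orbF.
  apply: le_trans (bound (r + 1) (M * s ^+ n)^-1 s _ _ _ _ _) _ => //.
  - by rewrite Er lte_fin ltrDl.
  - by rewrite Ev veq0 lte_fin divr_gt0// mulr_gt0// invr_gt0 mulr_gt0.
  - by rewrite invr_gt0 mulr_gt0.
  - by rewrite invrK; exact: Hs.
  rewrite lee_fin le_eqVlt; apply/orP; left; apply/eqP.
  rewrite invfM divfK ?gt_eqF// /M invf_div mulrA.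
  have : K * (r + 1) ^+ n != 0 by rewrite mulf_neq0 ?gt_eqF ?exprn_gt0.
  by move: (K * _ ^+ n) => z z0; field.
set W := v * (P / kappa) in Wn0 *.
have Wp : 0 < W by rewrite lt_neqAle eq_sym Wn0/= mulr_ge0// ltW.
have T0 : (0 <= Binv n A W^-1)%E.
  apply: ereal_sup_ubound; exists 0 => //=.
  by rewrite assocB_0// lee_fin invr_ge0 (ltW Wp).
(* Beyond max(t0, 1) one has B(t) >= 2/W > 1/W, so the supremum defining the inverse is finite. *)
have [t0 t0p Ht0] := assocB_growth n A n1 yA C1 C2 (2 / W).
have Tle : (Binv n A W^-1 <= (Num.max t0 1)%:E)%E.
  apply: ge_ereal_sup => _ [t [tp Ht] <-]; rewrite lee_fin leNgt; apply/negP.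
  rewrite gt_max => /andP[/ltW/Ht0 + /ltW t1] => /le_trans/(_ Ht).
  rewrite lee_fin mulrAC -[leRHS]mul1r ler_pM2r ?invr_gt0// leNgt => /negP; apply.
  by have := exprn_ege1 n t1 => ?; lra.
have [T ET Tp] : exists2 T, Binv n A W^-1 = T%:E & 0 <= T.
  by move: T0 Tle; case: Binv => // T Tp _; exists T.
rewrite ET -EFin_expe -!EFinM.
(* Raising the norm, W and T by d > 0 makes the requirements of [bound] hold; f is continuous at 0
   and f 0 is the right side. *)
pose f d := K * (r + d) ^+ n * ((W + d) * (T + d) ^+ n).
have Hf d : 0 < d -> (h <= (f d)%:E)%E.
  move=> d0; apply: bound.
  - by rewrite Er lte_fin ltrDl.
  - rewrite Ev lte_fin ltr_pdivlMr// -[ltLHS](@mulfK _ kappa) ?gt_eqF//.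
    rewrite mulrAC -(mulrA v) -/W mulrC ltr_pM2l// ltrDl//.
  - by rewrite addr_gt0.
  - by rewrite ltr_wpDl.
  (* Otherwise T + d would belong to the set whose supremum is T. *)
  - have : (W^-1%:E < assocB n A (T + d))%E.
      rewrite ltNge; apply/negP => H.
      have : ((T + d)%:E <= Binv n A W^-1)%E.
        apply: ereal_sup_ubound; exists (T + d) => //; split => //.
        by rewrite addr_ge0// ltW.
      by rewrite ET lee_fin gerDl leNgt d0.
    move=> /ltW; apply: le_trans; rewrite lee_fin lef_pV2 ?posrE ?addr_gt0//.
    by rewrite lerDl ltW.
have cf : f d @[d --> 0] --> f 0.
  have cD (c : R) : c + d @[d --> 0] --> c + 0.
    by apply: cvgD; [exact: cvg_cst|exact: cvg_id].
  have cX (c : R) : (c + d) ^+ n @[d --> 0] --> (c + 0) ^+ n.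
    exact: (cvg_comp _ _ (cD c) (@exprn_continuous R n (c + 0))).
  apply: cvgM; first by apply: cvgM; [exact: cvg_cst|exact: cX].
  by apply: cvgM; [exact: cD|exact: cX].
apply/lee_addgt0Pr => e e0; rewrite -EFinD.
have /cvgrPdist_le/(_ _ e0) := cf.
move=> /nbhs_ballP[d /= d0 Hd].
have d20 : 0 < d / 2 by rewrite divr_gt0.
apply: (le_trans (Hf _ d20)); rewrite lee_fin.
have : ball (0 : R) d (d / 2).
  by rewrite /ball/= sub0r normrN gtr0_norm// ltr_pdivrMr// ltr_pMr// ltr1n.
move=> /Hd; rewrite distrC => /(le_trans (ler_norm _)).
by rewrite /f !addr0 lerBlDl.
Qed.
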